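(* Let $R$ be a commutative noetherian ring, let $C$ be a semidualizing $R$-module, and let $M$ and $N$ be $R$-modules. For each $i$, there are natural isomorphisms $$\operatorname{Tor}^{\mathcal{P}_C\mathcal{M}}_i(M,N)\xrightarrow{\cong}\operatorname{Tor}^R_i(\operatorname{Hom}_R(C,M),C\otimes_R N)\xrightarrow{\cong}\operatorname{Tor}^{\mathcal{F}_C\mathcal{M}}_i(M,N)$$ and the comparison morphism $\varrho_i\colon\operatorname{Tor}^{\mathcal{P}_C\mathcal{M}}_i(-,-)\to\operatorname{Tor}^{\mathcal{F}_C\mathcal{M}}_i(-,-)$ is an isomorphism.
   Context: $R$ is a commutative noetherian ring. A finitely generated $R$-module $C$ is semidualizing if the homothety map $R\to\operatorname{Hom}_R(C,C)$ is an isomorphism and $\operatorname{Ext}^i_R(C,C)=0$ for all $i\geq 1$. $\mathcal{P}_C(R)$ is the class of $R$-modules isomorphic to $P\otimes_R C$ with $P$ projective, and $\mathcal{F}_C(R)$ is the class of $R$-modules isomorphic to $F\otimes_R C$ with $F$ flat; both are precovering. For a precovering class $\mathcal{X}$, a proper $\mathcal{X}$-resolution of $M$ is a complex $X=(\cdots\to X_1\to X_0\to 0)$ with each $X_i\in\mathcal{X}$ together with an augmentation $X_0\to M$ such that $X^+=(\cdots\to X_1\to X_0\to M\to 0)$ (with $M$ in degree $-1$) is a complex, not necessarily exact, and $\operatorname{Hom}_R(Y,X^+)$ is exact for all $Y\in\mathcal{X}$. If $Q$ is a proper $\mathcal{P}_C$-resolution of $M$ and $G$ is a proper $\mathcal{F}_C$-resolution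 of $M$, then for $i\geq 0$ $$\operatorname{Tor}^{\mathcal{P}_C\mathcal{M}}_i(M,N):=H_i(Q\otimes_R N),\qquad \operatorname{Tor}^{\mathcal{F}_C\mathcal{M}}_i(M,N):=H_i(G\otimes_R N).$$ These are independent of choices and functorial in both arguments. The natural transformation $\varrho_i$ is defined as follows: since $\mathcal{P}_C(R)\subseteq\mathcal{F}_C(R)$, the complex $\operatorname{Hom}_R(Y,G^+)$ is exact for every $Y\in\mathcal{P}_C(R)$, so there is a morphism of complexes $Q^+\to G^+$, unique up to homotopy, lifting the identity on $M$ in degree $-1$; $\varrho_i(M,N)$ is the map induced on $H_i$ by the resulting morphism $Q\otimes_R N\to G\otimes_R N$. *)

(* Defs.v *)
From HB Require Import structures.
From mathcomp Require Import all_boot all_algebra.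
From mathcomp Require Import boolp classical_sets functions.

Set Implicit Arguments.
Unset Strict Implicit.
Unset Printing Implicit Defensive.

Import GRing.Theory.
Local Open Scope ring_scope.
Local Open Scope quotient_scope.

Section LinearExt.
Variables (R : pzRingType) (U V : lmodType R).

Lemma linear_ext (f g : {linear U -> V}) : f =1 g -> f = g.
Proof.
case: f => f [[f1] [f2]]; case: g => g [[g1] [g2]] /= /funext fg.
case: g / fg g1 g2 => g1 g2.
by rewrite (Prop_irrelevance f1 g1) (Prop_irrelevance f2 g2).
Qed.

End LinearExt.

(* The R-module Hom_R(U, V), carried by the type {linear U -> V}. *)
Section HomModule.
Variables (R : comPzRingType) (U V : lmodType R).
Implicit Types f g h : {linear U -> V}.

HB.instance Definition _ := gen_eqMixin {linear U -> V}.
HB.instance Definition _ := gen_choiceMixin {linear U -> V}.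

Definition hom_zero : {linear U -> V} := \0.
Definition hom_opp f : {linear U -> V} := \- f.
Definition hom_add f g : {linear U -> V} := f \+ g.
Definition hom_scale (a : R) f : {linear U -> V} := a \*: f.

Fact hom_addA : associative hom_add.
Proof. by move=> f g h; apply: linear_ext => x /=; rewrite addrA. Qed.
Fact hom_addC : commutative hom_add.
Proof. by move=> f g; apply: linear_ext => x /=; rewrite addrC. Qed.
Fact hom_add0 : left_id hom_zero hom_add.
Proof. by move=> f; apply: linear_ext => x /=; rewrite add0r. Qed.
Fact hom_addN : left_inverse hom_zero hom_opp hom_add.
Proof. by move=> f; apply: linear_ext => x /=; rewrite addNr. Qed.

HB.instance Definition _ :=
  GRing.isZmodule.Build {linear U -> V} hom_addA hom_addC hom_add0 hom_addN.

Fact hom_scaleA a b f : hom_scale a (hom_scale b f) = hom_scale (a * b) f.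
Proof. by apply: linear_ext => x /=; rewrite scalerA. Qed.
Fact hom_scale1 : left_id 1 hom_scale.
Proof. by move=> f; apply: linear_ext => x /=; rewrite scale1r. Qed.
Fact hom_scaleDr : right_distributive hom_scale +%R.
Proof. by move=> a f g; apply: linear_ext => x /=; rewrite scalerDr. Qed.
Fact hom_scaleDl f : {morph hom_scale^~ f : a b / a + b}.
Proof. by move=> a b; apply: linear_ext => x /=; rewrite scalerDl. Qed.

HB.instance Definition _ := GRing.Zmodule_isLmodule.Build R {linear U -> V}
  hom_scaleA hom_scale1 hom_scaleDr hom_scaleDl.

End HomModule.

Section HomFunctor.
Variables (R : comPzRingType) (U V W : lmodType R).

Definition hom_post (f : {linear V -> W}) (h : {linear U -> V}) :
  {linear U -> W} := f \o h.

Fact hom_post_linear f : linear (hom_post f).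
Proof. by move=> a h k; apply: linear_ext => x /=; rewrite linearP. Qed.

HB.instance Definition _ f := GRing.isLinear.Build R {linear U -> V}
  {linear U -> W} *:%R (hom_post f) (hom_post_linear f).

Definition hom_pre (f : {linear U -> V}) (h : {linear V -> W}) :
  {linear U -> W} := h \o f.

Fact hom_pre_linear f : linear (hom_pre f).
Proof. by move=> a h k; apply: linear_ext => x. Qed.

HB.instance Definition _ f := GRing.isLinear.Build R {linear V -> W}
  {linear U -> W} *:%R (hom_pre f) (hom_pre_linear f).

End HomFunctor.

Lemma submodN (R : pzRingType) (V : lmodType R) (S : submodClosed V) (x : V) :
  (- x \in S) = (x \in S).
Proof.
suff sub y : y \in S -> - y \in S.
  by apply/idP/idP => /sub; rewrite ?opprK.
by move=> yS; rewrite -scaleN1r rpredZ.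
Qed.

Section SubQuotient.
Variables (R : pzRingType) (V : lmodType R) (S : submodClosed V).

Definition submod_of := {x : V | x \in S}.
HB.instance Definition _ := SubChoice.on submod_of.
HB.instance Definition _ := [SubChoice_isSubLmodule of submod_of by <:].

Definition quo_rel : rel V := fun x y => x - y \in S.

Fact quo_rel_refl : reflexive quo_rel.
Proof. by move=> x; rewrite /quo_rel subrr rpred0. Qed.
Fact quo_rel_sym : symmetric quo_rel.
Proof. by move=> x y; rewrite /quo_rel -[x - y]opprB submodN. Qed.
Fact quo_rel_trans : transitive quo_rel.
Proof.
move=> y x z xy yz; rewrite /quo_rel -(subrK y x) -addrA.
exact: (rpredD xy yz).
Qed.

Canonical quo_equiv :=
  EquivRel quo_rel quo_rel_refl quo_rel_sym quo_rel_trans.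

Definition quo_of := {eq_quot quo_rel}.
HB.instance Definition _ := Choice.on quo_of.
HB.instance Definition _ := EqQuotient.on quo_of.

Definition quo_pi (x : V) : quo_of := \pi x.

Lemma quo_piP x y : reflect (quo_pi x = quo_pi y) (x - y \in S).
Proof. by apply: (iffP idP) => [xy|/eqquotP //]; apply/eqquotP. Qed.

Lemma quo_pi0P x : reflect (quo_pi x = quo_pi 0) (x \in S).
Proof. by rewrite -[x in x \in S]subr0; exact: quo_piP. Qed.

Lemma quo_ind (P : quo_of -> Prop) : (forall x, P (quo_pi x)) -> forall q, P q.
Proof. by move=> Ppi q; rewrite -[q]reprK; exact: Ppi. Qed.

Lemma quo_reprP x : repr (quo_pi x) - x \in S.
Proof. by apply/quo_piP; rewrite /quo_pi reprK. Qed.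

Definition quo_add (p q : quo_of) := quo_pi (repr p + repr q).
Definition quo_opp (p : quo_of) := quo_pi (- repr p).
Definition quo_scale (a : R) (p : quo_of) := quo_pi (a *: repr p).

Fact quo_piD x y : quo_add (quo_pi x) (quo_pi y) = quo_pi (x + y).
Proof. by apply/quo_piP; rewrite opprD addrACA rpredD ?quo_reprP. Qed.
Fact quo_piN x : quo_opp (quo_pi x) = quo_pi (- x).
Proof. by apply/quo_piP; rewrite -opprD submodN quo_reprP. Qed.
Fact quo_piZ a x : quo_scale a (quo_pi x) = quo_pi (a *: x).
Proof. by apply/quo_piP; rewrite -scalerBr rpredZ ?quo_reprP. Qed.

Fact quo_addA : associative quo_add.
Proof.
elim/quo_ind=> x; elim/quo_ind=> y; elim/quo_ind=> z.
by rewrite !quo_piD addrA.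
Qed.
Fact quo_addC : commutative quo_add.
Proof. by elim/quo_ind=> x; elim/quo_ind=> y; rewrite !quo_piD addrC. Qed.
Fact quo_add0 : left_id (quo_pi 0) quo_add.
Proof. by elim/quo_ind=> x; rewrite quo_piD add0r. Qed.
Fact quo_addN : left_inverse (quo_pi 0) quo_opp quo_add.
Proof. by elim/quo_ind=> x; rewrite quo_piN quo_piD addNr. Qed.

HB.instance Definition _ :=
  GRing.isZmodule.Build quo_of quo_addA quo_addC quo_add0 quo_addN.

Fact quo_scaleA a b p : quo_scale a (quo_scale b p) = quo_scale (a * b) p.
Proof. by elim/quo_ind: p => x; rewrite !quo_piZ scalerA. Qed.
Fact quo_scale1 : left_id 1 quo_scale.
Proof. by elim/quo_ind=> x; rewrite quo_piZ scale1r. Qed.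
Fact quo_scaleDr : right_distributive quo_scale +%R.
Proof.
move=> a; elim/quo_ind=> x; elim/quo_ind=> y.
by rewrite [_ + _]quo_piD !quo_piZ [RHS]quo_piD scalerDr.
Qed.
Fact quo_scaleDl p : {morph quo_scale^~ p : a b / a + b}.
Proof.
by move=> a b; elim/quo_ind: p => x; rewrite !quo_piZ [RHS]quo_piD scalerDl.
Qed.

HB.instance Definition _ := GRing.Zmodule_isLmodule.Build R quo_of
  quo_scaleA quo_scale1 quo_scaleDr quo_scaleDl.

Fact quo_pi_linear : linear quo_pi.
Proof.
by move=> a x y; rewrite -quo_piD -quo_piZ.
Qed.
HB.instance Definition _ :=
  GRing.isLinear.Build R V quo_of *:%R quo_pi quo_pi_linear.

Lemma quo_pi_eq0 x : (quo_pi x == 0) = (x \in S).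
Proof. exact/eqP/quo_pi0P. Qed.

Section Lift.
Variables (W : lmodType R) (f : {linear V -> W}).
Hypothesis f0 : forall x, x \in S -> f x = 0.

Definition quo_lift of (forall x, x \in S -> f x = 0) :=
  fun p : quo_of => f (repr p).

Lemma quo_liftE x : quo_lift f0 (quo_pi x) = f x.
Proof.
by apply/eqP; rewrite /quo_lift -subr_eq0 -linearB f0 // quo_reprP.
Qed.

Fact quo_lift_linear : linear (quo_lift f0).
Proof.
move=> a; elim/quo_ind=> x; elim/quo_ind=> y.
by rewrite -linearP !quo_liftE linearP.
Qed.
HB.instance Definition _ :=
  GRing.isLinear.Build R quo_of W *:%R (quo_lift f0) quo_lift_linear.

End Lift.

End SubQuotient.

Section Corestriction.
Variables (R : pzRingType) (U V : lmodType R) (S : submodClosed V).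
Variables (f : {linear U -> V}) (fS : forall x, f x \in S).

Definition corestr (x : U) : submod_of S :=
  exist (fun y => y \in S) (f x) (fS x).
Fact corestr_linear : linear corestr.
Proof. by move=> a x y; apply: val_inj; rewrite /= linearP. Qed.
HB.instance Definition _ :=
  GRing.isLinear.Build R U (submod_of S) *:%R corestr corestr_linear.

End Corestriction.

Section Span.
Variables (R : pzRingType) (V : lmodType R) (A : V -> Prop).

Definition span_pred : pred V := fun x =>
  `[< forall S : submodClosed V, (forall a, A a -> a \in S) -> x \in S >].

Fact span_closed : subsemimod_closed span_pred.
Proof.
split=> [|a x]; last first.
  by move=> /asboolP xA; apply/asboolP => S AS; rewrite rpredZ ?xA.
split; first by apply/asboolP => S _; rewrite rpred0.
move=> x y /asboolP xA /asboolP yA; apply/asboolP => S AS.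
by rewrite rpredD ?xA ?yA.
Qed.
HB.instance Definition _ := GRing.isSubmodClosed.Build R V span_pred span_closed.

Definition gen_submod : submodClosed V := GRing.SubmodClosed.clone R V span_pred _.

Lemma mem_span a : A a -> a \in gen_submod.
Proof. by move=> Aa; apply/asboolP => S; exact. Qed.

Lemma span_min (S : submodClosed V) :
  (forall a, A a -> a \in S) -> forall x, x \in gen_submod -> x \in S.
Proof. by move=> AS x /asboolP; exact. Qed.

End Span.

Section KernelImage.
Variables (R : pzRingType) (U V : lmodType R) (f : {linear U -> V}).

Definition ker_pred : pred U := fun x => f x == 0.
Fact ker_closed : subsemimod_closed ker_pred.
Proof.
split=> [|a x]; last first.
  by rewrite !unfold_in linearZZ => /eqP ->; rewrite scaler0.
split=> [|x y]; first by rewrite unfold_in linear0.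
by rewrite !unfold_in linearD => /eqP -> /eqP ->; rewrite addr0.
Qed.
HB.instance Definition _ := GRing.isSubmodClosed.Build R U ker_pred ker_closed.

Definition ker : submodClosed U := GRing.SubmodClosed.clone R U ker_pred _.

Lemma kerP x : reflect (f x = 0) (x \in ker).
Proof. exact: eqP. Qed.

Definition im_pred : pred V := fun y => `[< exists x, f x = y >].
Fact im_closed : subsemimod_closed im_pred.
Proof.
split=> [|a x]; last first.
  by case/asboolP=> u <-; apply/asboolP; exists (a *: u); rewrite linearZZ.
split=> [|_ _ /asboolP[u <-] /asboolP[v <-]]; apply/asboolP.
  by exists 0; rewrite linear0.
by exists (u + v); rewrite linearD.
Qed.
HB.instance Definition _ := GRing.isSubmodClosed.Build R V im_pred im_closed.

Definition im : submodClosed V := GRing.SubmodClosed.clone R V im_pred _.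

Lemma imP y : reflect (exists x, f x = y) (y \in im).
Proof. exact: asboolP. Qed.

Variable S : submodClosed V.

Definition preim_pred : pred U := fun x => f x \in S.
Fact preim_closed : subsemimod_closed preim_pred.
Proof.
have memE x : (x \in preim_pred) = (f x \in S) by [].
split=> [|a x]; last by rewrite !memE => xS; rewrite linearZZ rpredZ.
split=> [|x y]; first by rewrite memE linear0 rpred0.
by rewrite !memE => xS yS; rewrite linearD rpredD.
Qed.
HB.instance Definition _ :=
  GRing.isSubmodClosed.Build R U preim_pred preim_closed.

Definition preim : submodClosed U := GRing.SubmodClosed.clone R U preim_pred _.

Lemma preimE x : (x \in preim) = (f x \in S).
Proof. by []. Qed.

End KernelImage.

(* The free module on T: finitely supported functions T -> R. *)
Section Free.
Variables (R : comPzRingType) (T : choiceType).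

Definition fin_supp_pred : pred (T -> R^o) := fun u =>
  `[< exists s : seq T, forall t, t \notin s -> u t = 0 >].

Fact fin_supp_closed : subsemimod_closed fin_supp_pred.
Proof.
split=> [|a u]; last first.
  by case/asboolP=> s us; apply/asboolP; exists s => t /us;
    rewrite scalrfctE => ->; rewrite scaler0.
split=> [|u v /asboolP[s us] /asboolP[r vr]]; apply/asboolP.
  by exists [::].
exists (s ++ r) => t; rewrite mem_cat negb_or => /andP[/us ut /vr vt].
by rewrite addrfctE ut vt addr0.
Qed.
HB.instance Definition _ :=
  GRing.isSubmodClosed.Build R (T -> R^o) fin_supp_pred fin_supp_closed.

Definition fin_supp : submodClosed (T -> R^o) :=
  GRing.SubmodClosed.clone R (T -> R^o) fin_supp_pred _.

Definition free_mod : lmodType R := submod_of fin_supp.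

Definition coef (u : free_mod) : T -> R := val u.

Lemma free_supp (u : free_mod) :
  exists s : seq T, uniq s /\ forall t, t \notin s -> coef u t = 0.
Proof.
have /asboolP[s us] := valP u.
by exists (undup s); split=> [|t]; rewrite ?undup_uniq// mem_undup => /us.
Qed.

Lemma coefP (u v : free_mod) : coef u =1 coef v -> u = v.
Proof. by move=> /funext uv; exact: val_inj. Qed.

Fact free_gen_subproof (t : T) :
  (fun x => if x == t then 1 else 0 : R^o) \in fin_supp.
Proof.
by apply/asboolP; exists [:: t] => x; rewrite inE => /negPf ->.
Qed.
Definition free_gen (t : T) : free_mod :=
  exist (fun u => u \in fin_supp) _ (free_gen_subproof t).

Lemma coef_gen t x : coef (free_gen t) x = if x == t then 1 else 0.
Proof. by []. Qed.

Lemma coef_linear a u v t : coef (a *: u + v) t = a * coef u t + coef v t.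
Proof. by []. Qed.

Section FreeExt.
Variables (V : lmodType R) (g : T -> V).

Definition free_ext (u : free_mod) : V :=
  let s := proj1_sig (cid (free_supp u)) in
  \sum_(t <- s) coef u t *: g t.

Lemma free_extE (u : free_mod) (s : seq T) : uniq s ->
  (forall t, t \notin s -> coef u t = 0) ->
  free_ext u = \sum_(t <- s) coef u t *: g t.
Proof.
move=> us u0; rewrite /free_ext; case: cid => r /= [ur r0].
have red q : (forall t, t \notin q -> coef u t = 0) ->
    \sum_(t <- q) coef u t *: g t
    = \sum_(t <- [seq t <- q | coef u t != 0]) coef u t *: g t.
  move=> q0; rewrite big_filter [RHS]big_mkcond /=; apply: eq_bigr => t _.
  by case: eqP => //= ->; rewrite scale0r.
rewrite (red r)// (red s)//; apply: perm_big; apply: uniq_perm.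
- exact: filter_uniq.
- exact: filter_uniq.
move=> t; rewrite !mem_filter; case: eqP => //= ut.
have inq q : (forall t, t \notin q -> coef u t = 0) -> t \in q.
  by move=> q0; apply: contra_notT ut => /q0.
by rewrite !inq.
Qed.

Fact free_ext_linear : linear free_ext.
Proof.
move=> a u v; have [s [us u0]] := free_supp u; have [r [ur v0]] := free_supp v.
have us0 t : t \notin undup (s ++ r) -> coef u t = 0.
  by rewrite mem_undup mem_cat negb_or => /andP[/u0].
have vr0 t : t \notin undup (s ++ r) -> coef v t = 0.
  by rewrite mem_undup mem_cat negb_or => /andP[_ /v0].
rewrite !(@free_extE _ (undup (s ++ r))) ?undup_uniq//; last first.
  by move=> t tsr; rewrite coef_linear us0// vr0// mulr0 addr0.
rewrite scaler_sumr -big_split; apply: eq_bigr => t _ /=.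
by rewrite coef_linear scalerDl scalerA.
Qed.
HB.instance Definition _ :=
  GRing.isLinear.Build R free_mod V *:%R free_ext free_ext_linear.

Lemma free_ext_gen t : free_ext (free_gen t) = g t.
Proof.
rewrite (@free_extE _ [:: t])//; last first.
  by move=> x; rewrite inE coef_gen => /negPf ->.
by rewrite big_seq1 coef_gen eqxx scale1r.
Qed.

End FreeExt.

Lemma coef_sum (I : Type) (s : seq I) (F : I -> free_mod) t :
  coef (\sum_(i <- s) F i) t = \sum_(i <- s) coef (F i) t.
Proof.
elim/big_rec2: _ => //= i y x _ <-.
by rewrite -[F i]scale1r coef_linear mul1r scale1r.
Qed.

Lemma free_decomp (u : free_mod) (s : seq T) : uniq s ->
  (forall t, t \notin s -> coef u t = 0) ->
  u = \sum_(t <- s) coef u t *: free_gen t.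
Proof.
move=> us u0; apply: coefP => x; rewrite coef_sum.
rewrite (eq_bigr (fun t => if x == t then coef u t else 0)); last first.
  move=> t _; rewrite -[_ *: _]addr0 coef_linear addr0 coef_gen.
  by case: ifP; rewrite ?mulr1 ?mulr0.
rewrite -big_mkcond /=; have [xs|/[dup] xs /u0 ->] := boolP (x \in s).
  rewrite -big_filter (@eq_filter _ _ (pred1 x)); last by move=> t; exact: eq_sym.
  by rewrite filter_pred1_uniq ?big_seq1.
rewrite big_seq_cond big_pred0// => t.
by apply: contraNF xs => /andP[ts /eqP ->].
Qed.

Lemma free_ext_unique (V : lmodType R) (f h : {linear free_mod -> V}) :
  (forall t, f (free_gen t) = h (free_gen t)) -> f =1 h.
Proof.
move=> fh u; have [s [us u0]] := free_supp u.
rewrite (free_decomp us u0) !linear_sum; apply: eq_bigr => t _.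
by rewrite !linearZZ fh.
Qed.

End Free.

Section Tensor.
Variables (R : comPzRingType) (M N : lmodType R).

Local Notation gen m n := (free_gen R (m, n)).

Inductive tensor_relator : free_mod R (M * N)%type -> Prop :=
| TensorDl m m' n : tensor_relator (gen (m + m') n - gen m n - gen m' n)
| TensorDr m n n' : tensor_relator (gen m (n + n') - gen m n - gen m n')
| TensorZl a m n : tensor_relator (gen (a *: m) n - a *: gen m n)
| TensorZr a m n : tensor_relator (gen m (a *: n) - a *: gen m n).

Definition tensor : lmodType R := quo_of (gen_submod tensor_relator).

Definition tens (m : M) (n : N) : tensor := quo_pi _ (gen m n).

Lemma tens_linear_l n : linear (tens^~ n).
Proof.
move=> a m m'; rewrite /tens -linearP; apply/quo_piP.
have -> : gen (a *: m + m') n - (a *: gen m n + gen m' n)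
  = (gen (a *: m + m') n - gen (a *: m) n - gen m' n)
    + (gen (a *: m) n - a *: gen m n).
  by rewrite [_ - gen m' n]addrAC addrA subrK opprD addrA addrAC.
by rewrite rpredD// mem_span//; [exact: TensorDl|exact: TensorZl].
Qed.

Lemma tens_linear_r m : linear (tens m).
Proof.
move=> a n n'; rewrite /tens -linearP; apply/quo_piP.
have -> : gen m (a *: n + n') - (a *: gen m n + gen m n')
  = (gen m (a *: n + n') - gen m (a *: n) - gen m n')
    + (gen m (a *: n) - a *: gen m n).
  by rewrite [_ - gen m n']addrAC addrA subrK opprD addrA addrAC.
by rewrite rpredD// mem_span//; [exact: TensorDr|exact: TensorZr].
Qed.

HB.instance Definition _ m :=
  GRing.isLinear.Build R N tensor *:%R (tens m) (tens_linear_r m).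

Lemma tensDl m m' n : tens (m + m') n = tens m n + tens m' n.
Proof. by have := tens_linear_l n 1 m m'; rewrite !scale1r. Qed.
Lemma tensZl a m n : tens (a *: m) n = a *: tens m n.
Proof.
have := tens_linear_l n a m (m - m); rewrite subrr addr0 => ->.
have := tens_linear_l n 1 0 0; rewrite !scale1r addr0.
by move/eqP; rewrite -subr_eq0 opprD addrA subrr add0r oppr_eq0 => /eqP ->;
  rewrite addr0.
Qed.
Lemma tensDr m n n' : tens m (n + n') = tens m n + tens m n'.
Proof. exact: linearD. Qed.
Lemma tensZr a m n : tens m (a *: n) = a *: tens m n.
Proof. exact: linearZZ. Qed.

Lemma tens0l n : tens 0 n = 0.
Proof. by rewrite -[0 in LHS](scale0r 0) tensZl scale0r. Qed.

Lemma tensor_ind (P : tensor -> Prop) :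
  (forall m n, P (tens m n)) -> (forall x y, P x -> P y -> P (x + y)) ->
  forall x, P x.
Proof.
move=> Ppure PD; apply: quo_ind => u; have [s [us u0]] := free_supp u.
rewrite (free_decomp us u0) linear_sum; elim: s {us u0} => [|[m n] s IHs].
  by rewrite big_nil -(tens0l 0); exact: Ppure.
by rewrite big_cons; apply: PD => //; rewrite linearZZ -tensZl; exact: Ppure.
Qed.

Lemma tensor_ext (V : lmodType R) (f h : {linear tensor -> V}) :
  (forall m n, f (tens m n) = h (tens m n)) -> f =1 h.
Proof.
move=> fh; elim/tensor_ind => // x y fhx fhy.
by rewrite !linearD fhx fhy.
Qed.

Section TensorLift.
Variables (V : lmodType R) (b : M -> N -> V).
Hypotheses (bl : forall n, linear (b^~ n)) (br : forall m, linear (b m)).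

Fact tensor_lift_subproof u :
  u \in gen_submod tensor_relator -> free_ext (fun p => b p.1 p.2) u = 0.
Proof.
set f := free_ext _ => uS; apply/(kerP f).
apply: span_min uS => {}u; rewrite /f.
have blD m m' n : b (m + m') n = b m n + b m' n.
  by have := bl n 1 m m'; rewrite !scale1r.
have brD m n n' : b m (n + n') = b m n + b m n'.
  by have := br m 1 n n'; rewrite !scale1r.
have bl0 n : b 0 n = 0 by apply: (addIr (b 0 n)); rewrite -blD !add0r.
have br0 m : b m 0 = 0 by apply: (addIr (b m 0)); rewrite -brD !add0r.
case=> [m m' n|m n n'|a m n|a m n]; apply/kerP;
  rewrite !linearB ?linearZZ /= !free_ext_gen /=.
- by rewrite blD addrAC addrK subrr.
- by rewrite brD addrAC addrK subrr.
- by have := bl n a m 0; rewrite addr0 bl0 addr0 => ->; rewrite scalerN subrr.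
- by have := br m a n 0; rewrite addr0 br0 addr0 => ->; rewrite scalerN subrr.
Qed.

Definition tensor_lift (x : tensor) : V := quo_lift tensor_lift_subproof x.

Fact tensor_lift_linear : linear tensor_lift.
Proof. exact: linearP. Qed.
HB.instance Definition _ :=
  GRing.isLinear.Build R tensor V *:%R tensor_lift tensor_lift_linear.

Lemma tensor_liftE m n : tensor_lift (tens m n) = b m n.
Proof. exact: etrans (quo_liftE _ _) (free_ext_gen _ _). Qed.

End TensorLift.

End Tensor.

Notation "M ⊗ N" := (tensor M N) (at level 40, left associativity).

Section TensorMap.
Variables (R : comPzRingType) (M M' N N' : lmodType R).
Variables (f : {linear M -> M'}) (g : {linear N -> N'}).

Fact tensor_map_l n : linear (fun m => tens (f m) (g n)).
Proof. by move=> a m m'; rewrite linearP tens_linear_l. Qed.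
Fact tensor_map_r m : linear (fun n => tens (f m) (g n)).
Proof. by move=> a n n'; rewrite !linearP. Qed.

Definition tensor_map (x : M ⊗ N) : M' ⊗ N' :=
  tensor_lift tensor_map_l tensor_map_r x.

Fact tensor_map_linear : linear tensor_map.
Proof. exact: linearP. Qed.
HB.instance Definition _ :=
  GRing.isLinear.Build R (M ⊗ N) (M' ⊗ N') *:%R tensor_map tensor_map_linear.

Lemma tensor_mapE m n : tensor_map (tens m n) = tens (f m) (g n).
Proof. exact: tensor_liftE. Qed.

End TensorMap.

Arguments tensor_map : simpl never.

Section TensorMapTheory.
Variable R : comPzRingType.
Implicit Types M N : lmodType R.

Lemma tensor_map_eq M M' N N' (f f' : {linear M -> M'}) (g g' : {linear N -> N'}) :
  f =1 f' -> g =1 g' -> tensor_map f g =1 tensor_map f' g'.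
Proof. by move=> ff gg; apply: tensor_ext => m n; rewrite /= !tensor_mapE ff gg. Qed.

Lemma tensor_map_id M N :
  tensor_map (idfun : {linear M -> M}) (idfun : {linear N -> N}) =1 id.
Proof.
by apply: (@tensor_ext _ _ _ _ _ idfun) => m n; rewrite /= tensor_mapE.
Qed.

Lemma tensor_map_comp M M' M'' N N' N'' (f : {linear M -> M'})
    (f' : {linear M' -> M''}) (g : {linear N -> N'}) (g' : {linear N' -> N''}) x :
  tensor_map f' g' (tensor_map f g x) = tensor_map (f' \o f) (g' \o g) x.
Proof.
move: x; apply: (@tensor_ext _ _ _ _ (tensor_map f' g' \o tensor_map f g)) => m n.
by rewrite /= !tensor_mapE.
Qed.

End TensorMapTheory.

Arguments tensor_lift : simpl never.

Section ModuleClasses.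
Variable R : comPzRingType.
Implicit Types M N P X : lmodType R.

Definition isomorphic M N := exists f : {linear M -> N}, bijective f.

Definition projective P := forall M N (g : {linear M -> N}) (f : {linear P -> N}),
  (forall y, exists x, g x = y) -> exists h : {linear P -> M}, forall x, g (h x) = f x.

Definition flat P := forall M N (f : {linear M -> N}),
  injective f -> injective (tensor_map f (idfun : {linear P -> P})).

Definition PC (C : lmodType R) X := exists P, projective P /\ isomorphic X (P ⊗ C).
Definition FC (C : lmodType R) X := exists F, flat F /\ isomorphic X (F ⊗ C).

End ModuleClasses.

Section Homology.
Variables (R : pzRingType) (X Y Z : lmodType R).
Variables (f : {linear X -> Y}) (g : {linear Y -> Z}).

Definition cycles : lmodType R := submod_of (ker g).
Definition cycle_val (z : cycles) : Y := val z.
Fact cycle_val_linear : linear cycle_val.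
Proof. by []. Qed.
HB.instance Definition _ :=
  GRing.isLinear.Build R cycles Y *:%R cycle_val cycle_val_linear.

(* ker g / (im f ∩ ker g); g o f = 0 is not required. *)
Definition homology : lmodType R := quo_of (preim cycle_val (im f)).

Definition hclass (z : cycles) : homology := quo_pi _ z.
Fact hclass_linear : linear hclass.
Proof. exact: quo_pi_linear. Qed.
HB.instance Definition _ :=
  GRing.isLinear.Build R cycles homology *:%R hclass hclass_linear.

Lemma hclass_ind (P : homology -> Prop) :
  (forall z, P (hclass z)) -> forall c, P c.
Proof. exact: quo_ind. Qed.

Lemma hclass_eq0 z : hclass z = 0 <-> exists x, f x = cycle_val z.
Proof.
split=> [/eqP|fz]; last by apply/eqP; rewrite quo_pi_eq0 preimE; apply/imP.
by rewrite quo_pi_eq0 preimE => /imP.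
Qed.

End Homology.

Section HomologyMap.
Variables (R : pzRingType) (X Y Z X' Y' Z' : lmodType R).
Variables (f : {linear X -> Y}) (g : {linear Y -> Z}).
Variables (f' : {linear X' -> Y'}) (g' : {linear Y' -> Z'}).
Variable b : {linear Y -> Y'}.
Hypothesis bf : forall x, exists x', f' x' = b (f x).
Hypothesis bg : forall y, g y = 0 -> g' (b y) = 0.

Fact cycles_map_subproof (z : cycles g) : b (cycle_val z) \in ker g'.
Proof. by apply/kerP/bg/kerP; exact: valP. Qed.

Definition cycles_map (z : cycles g) : cycles g' :=
  exist (fun y => y \in ker g') _ (cycles_map_subproof z).
Fact cycles_map_linear : linear cycles_map.
Proof. by move=> a y z; apply: val_inj; rewrite /= linearP. Qed.
HB.instance Definition _ :=
  GRing.isLinear.Build R (cycles g) (cycles g') *:%R cycles_map cycles_map_linear.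

Definition hclass_map : {linear cycles g -> homology f' g'} :=
  @hclass _ _ _ _ f' g' \o cycles_map.

Fact homology_map_subproof z :
  z \in preim (@cycle_val _ _ _ g) (im f) -> hclass_map z = 0.
Proof.
rewrite preimE => /imP[x fx]; apply/hclass_eq0.
by have [x' fx'] := bf x; exists x'; rewrite fx' fx.
Qed.

Definition homology_map (c : homology f g) : homology f' g' :=
  quo_lift homology_map_subproof c.
Fact homology_map_linear : linear homology_map.
Proof. exact: linearP. Qed.
HB.instance Definition _ := GRing.isLinear.Build R
  (homology f g) (homology f' g') *:%R homology_map homology_map_linear.

Lemma homology_mapE z :
  homology_map (hclass f z) = hclass f' (cycles_map z).
Proof. exact: quo_liftE. Qed.

End HomologyMap.

Arguments cycle_val : simpl never.
Arguments hclass : simpl never.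
Arguments homology_map : simpl never.

Section Complexes.
Variable R : comPzRingType.

Record complex := Complex {
  obj :> nat -> lmodType R;
  diff : forall i, {linear obj i.+1 -> obj i};
  diffK : forall i x, diff i (diff i.+1 x) = 0 }.

(* The differential leaving degree i; it is zero for i = 0. *)
Definition bd (X : complex) (i : nat) : {linear X i -> X i.-1} :=
  match i with 0 => \0 | j.+1 => diff X j end.

Definition homol (i : nat) (X : complex) : lmodType R := homology (diff X i) (bd X i).

Definition acyclic (X : complex) :=
  forall i (x : X i), bd X i x = 0 -> exists y, diff X i y = x.

Record chain_map (X Y : complex) := ChainMap {
  cmap :> forall i, {linear X i -> Y i};
  cmapP : forall i x, cmap i (diff X i x) = diff Y i (cmap i.+1 x) }.

Section HMap.
Variables (X Y : complex) (phi : chain_map X Y) (i : nat).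

Fact H_map_im x : exists y, diff Y i y = phi i (diff X i x).
Proof. by exists (phi i.+1 x); rewrite cmapP. Qed.

Fact H_map_ker x : bd X i x = 0 -> bd Y i (phi i x) = 0.
Proof. by case: i x => //= j x; rewrite -cmapP => ->; rewrite linear0. Qed.

Definition homol_map (c : homol i X) : homol i Y := homology_map H_map_im H_map_ker c.
Fact H_map_linear : linear homol_map.
Proof. exact: linearP. Qed.
HB.instance Definition _ :=
  GRing.isLinear.Build R (homol i X) (homol i Y) *:%R homol_map H_map_linear.

End HMap.

Arguments homol_map {X Y} phi i c : simpl never.

Section TensorComplex.
Variables (X : complex) (N : lmodType R).

Definition tensor_diff i : {linear X i.+1 ⊗ N -> X i ⊗ N} :=
  tensor_map (diff X i) (idfun : {linear N -> N}).

Fact tensor_complex_subproof i x : tensor_diff i (tensor_diff i.+1 x) = 0.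
Proof.
elim/tensor_ind: x => [x n|x y IHx IHy]; last by rewrite !linearD IHx IHy addr0.
by rewrite /= !tensor_mapE diffK tens0l.
Qed.

Definition tensor_complex := Complex tensor_complex_subproof.

End TensorComplex.

Section TensorChain.
Variables (X Y : complex) (phi : chain_map X Y).
Variables (N N' : lmodType R) (g : {linear N -> N'}).

Fact tensor_chain_subproof i x :
  tensor_map (phi i) g (tensor_diff X N i x)
  = tensor_diff Y N' i (tensor_map (phi i.+1) g x).
Proof.
elim/tensor_ind: x => [x n|x y IHx IHy]; last first.
  by rewrite !linearD [X in X + _]IHx [X in _ + X]IHy.
by rewrite /= !tensor_mapE cmapP.
Qed.

Definition tensor_chain :
  chain_map (tensor_complex X N) (tensor_complex Y N') :=
  @ChainMap (tensor_complex X N) (tensor_complex Y N')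
    (fun i => tensor_map (phi i) g) tensor_chain_subproof.

End TensorChain.

Section HomComplex.
Variables (A : lmodType R) (X : complex).

Fact hom_complex_subproof i (h : {linear A -> X i.+2}) :
  hom_post (diff X i) (hom_post (diff X i.+1) h) = 0.
Proof. by apply: linear_ext => x /=; rewrite diffK. Qed.

Definition hom_complex : complex :=
  @Complex (fun i => {linear A -> X i}) (fun i => hom_post (diff X i))
    hom_complex_subproof.

End HomComplex.

Record augmented (M : lmodType R) := Augmented {
  acomplex :> complex;
  aug : {linear acomplex 0 -> M};
  augK : forall x, aug (diff acomplex 0 x) = 0 }.

Section Plus.
Variables (M : lmodType R) (X : augmented M).

Definition plus_obj (i : nat) : lmodType R :=
  match i with 0 => M | j.+1 => X j end.
Definition plus_diff (i : nat) : {linear plus_obj i.+1 -> plus_obj i} :=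
  match i with 0 => aug X | j.+1 => diff X j end.
Fact plus_subproof i x : plus_diff i (plus_diff i.+1 x) = 0.
Proof. by case: i x => [|i] x; [exact: augK|exact: diffK]. Qed.

(* The augmented complex X^+, shifted so that M sits in degree 0, not -1. *)
Definition aug_complex : complex := Complex plus_subproof.

End Plus.

Definition is_proper (cX : lmodType R -> Prop) (M : lmodType R) (X : augmented M) :=
  forall A, cX A -> acyclic (hom_complex A (aug_complex X)).

Record proper_resolution (cX : lmodType R -> Prop) (M : lmodType R) :=
  ProperResolution {
    resolution :> augmented M;
    resolution_in : forall i, cX (resolution i);
    resolution_proper : is_proper cX resolution }.

End Complexes.

Arguments homol_map {R X Y} phi i c : simpl never.

Section Lifting.
Variable R : comPzRingType.
Variables (M M' : lmodType R) (f : {linear M -> M'}).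
Variables (P : augmented M) (G : augmented M').

Definition lifts (phi : chain_map P G) := forall x, aug G (phi 0 x) = f (aug P x).

Variable cX : lmodType R -> Prop.
Hypotheses (PX : forall i, cX (P i)) (GX : is_proper cX G).

Record partial_lift (n : nat) := PartialLift {
  lift_src : {linear aug_complex P n -> aug_complex G n};
  lift_tgt : {linear aug_complex P n.+1 -> aug_complex G n.+1};
  liftE : forall x, diff (aug_complex G) n (lift_tgt x) = lift_src (diff (aug_complex P) n x) }.

Lemma extend_lift n (a : {linear aug_complex P n -> aug_complex G n}) :
  (forall x, bd (aug_complex G) n (a (diff (aug_complex P) n x)) = 0) ->
  {b : {linear aug_complex P n.+1 -> aug_complex G n.+1} |
   forall x, diff (aug_complex G) n (b x) = a (diff (aug_complex P) n x)}.
Proof.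
move=> da; apply: cid.
have h0 : bd (hom_complex (P n) (aug_complex G)) n
    (a \o diff (aug_complex P) n : {linear aug_complex P n.+1 -> aug_complex G n}) = 0.
  by case: n a da => [|n] a da; apply: linear_ext => // x; exact: da.
have [b bh] := GX (PX n) h0.
by exists b => x; have := congr1 (fun k : {linear _ -> _} => k x) bh.
Qed.

Definition lift0 : partial_lift 0 :=
  let: exist b bE := @extend_lift 0 f (fun=> erefl) in @PartialLift 0 f b bE.

Fact liftS_subproof n (l : partial_lift n) x :
  bd (aug_complex G) n.+1 (lift_tgt l (diff (aug_complex P) n.+1 x)) = 0.
Proof. by rewrite [LHS]liftE diffK linear0. Qed.

Definition liftS n (l : partial_lift n) : partial_lift n.+1 :=
  let: exist b bE := extend_lift (liftS_subproof l) in PartialLift bE.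

Fixpoint lift_seq n : partial_lift n :=
  if n is m.+1 then liftS (lift_seq m) else lift0.

Lemma lift_src0 : lift_src (lift_seq 0) = f.
Proof. by rewrite /= /lift0; case: extend_lift. Qed.

Lemma lift_srcS n : lift_src (lift_seq n.+1) = lift_tgt (lift_seq n).
Proof. by rewrite /= /liftS; case: extend_lift. Qed.

Fact lift_subproof n x : lift_tgt (lift_seq n) (diff P n x)
  = diff G n (lift_tgt (lift_seq n.+1) x).
Proof.
by rewrite [RHS](liftE (lift_seq n.+1)) lift_srcS.
Qed.

Lemma lift_exists : exists phi : chain_map P G, lifts phi.
Proof.
exists (@ChainMap _ P G (fun n => lift_tgt (lift_seq n)) lift_subproof) => x.
by rewrite [LHS](liftE (lift_seq 0)) lift_src0.
Qed.

Definition lift_chain : chain_map P G := projT1 (cid lift_exists).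

Lemma liftP : lifts lift_chain.
Proof. exact: projT2 (cid lift_exists). Qed.

End Lifting.

Section Projective.
Variable R : comPzRingType.
Implicit Types (A M N P : lmodType R) (T : choiceType).

Lemma free_projective T : projective (free_mod R T).
Proof.
move=> M N g f gsurj; pose h t := projT1 (cid (gsurj (f (free_gen R t)))).
exists (free_ext h) => x; apply: (@free_ext_unique _ _ _ (g \o free_ext h) f) => t.
by rewrite /= free_ext_gen; exact: projT2 (cid (gsurj (f (free_gen R t)))).
Qed.

Lemma acyclic_proper M (X : augmented M) :
  acyclic (aug_complex X) -> is_proper (@projective R) X.
Proof.
move=> exX A projA i h h0.
have hk x : h x \in ker (bd (aug_complex X) i).
  apply/kerP; case: i h h0 => [|i] h h0 //.
  exact: (congr1 (fun k : {linear _ -> _} => k x) h0).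
have dk x : diff (aug_complex X) i x \in ker (bd (aug_complex X) i).
  by apply/kerP; case: i {h h0 hk} x => [|i] x //; exact: diffK.
have [|k hE] := projA _ _ (corestr dk) (corestr hk).
  move=> y; have [x xy] := exX i (val y) (kerP _ _ (valP y)).
  by exists x; apply: val_inj.
by exists k; apply: linear_ext => x; exact: (congr1 val (hE x)).
Qed.

Section FreeResolution.
Variable M : lmodType R.

Definition free_cover (A : lmodType R) : {linear free_mod R A -> A} := free_ext id.

Lemma free_cover_surj A (a : A) : exists u, free_cover A u = a.
Proof. by exists (free_gen R a); exact: free_ext_gen. Qed.

Fixpoint syzygy (n : nat) : lmodType R :=
  if n is m.+1 then submod_of (ker (free_cover (syzygy m))) else M.

Definition free_diff n : {linear free_mod R (syzygy n.+1) -> free_mod R (syzygy n)} :=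
  val \o free_cover (syzygy n.+1).

Fact free_coverK n x : free_cover (syzygy n) (free_diff n x) = 0.
Proof. by apply/kerP; exact: valP. Qed.

Fact free_diffK n x : free_diff n (free_diff n.+1 x) = 0.
Proof. by rewrite [LHS](congr1 val (free_coverK x)). Qed.

Definition free_augmented : augmented M :=
  @Augmented R M (Complex free_diffK) (free_cover M) (@free_coverK 0).

Lemma free_augmented_acyclic : acyclic (aug_complex free_augmented).
Proof.
have ex n u : free_cover (syzygy n) u = 0 -> exists v, free_diff n v = u.
  move=> /kerP uk; have [v vu] := free_cover_surj
    (exist (fun u => u \in ker (free_cover (syzygy n))) u uk : syzygy n.+1).
  by exists v; exact: (congr1 val vu).
case=> [|[|n]] x; first by move=> _; exact: free_cover_surj.
  exact: (ex 0).
by move=> xn; apply: (ex n.+1); exact: val_inj.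
Qed.

Definition free_resolution : proper_resolution (@projective R) M :=
  @ProperResolution R (@projective R) M free_augmented
    (fun i => @free_projective (syzygy i))
    (acyclic_proper free_augmented_acyclic).

End FreeResolution.

Section FreeFlat.
Variables (T : choiceType) (A : lmodType R).

Fact tensor_coef_l t (u : free_mod R T) : linear (fun x : A => coef u t *: x).
Proof. by move=> a x y; rewrite scalerDr !scalerA mulrC. Qed.
Fact tensor_coef_r t (x : A) : linear (fun u : free_mod R T => coef u t *: x).
Proof. by move=> a u v; rewrite coef_linear scalerDl scalerA. Qed.

Definition tensor_coef t : {linear A ⊗ free_mod R T -> A} :=
  tensor_lift (tensor_coef_l t) (tensor_coef_r t).

Lemma tensor_coef_decomp z : exists s : seq T,
  forall r, uniq r -> {subset s <= r} ->
  z = \sum_(t <- r) tens (tensor_coef t z) (free_gen R t).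
Proof.
elim/tensor_ind: z => [x u|y z [s sE] [s' sE']].
  have [s [us u0]] := free_supp u; exists s => r ur sr.
  rewrite {1}(@free_decomp _ _ u r)//; last first.
    by move=> t tr; apply: u0; apply: contra tr; exact: sr.
  rewrite linear_sum; apply: eq_bigr => t _.
  by rewrite /tensor_coef /= tensor_liftE tensZr tensZl.
exists (s ++ s') => r ur sr.
rewrite {1}(sE r)//; last by move=> t ts; rewrite sr// mem_cat ts.
rewrite {1}(sE' r)//; last by move=> t ts; rewrite sr// mem_cat ts orbT.
by rewrite -big_split; apply: eq_bigr => t _; rewrite /= linearD tensDl.
Qed.

End FreeFlat.

Lemma free_flat T : flat (free_mod R T).
Proof.
move=> M N f finj y z fyz.
have coefE t x : tensor_coef N t (tensor_map f (idfun : {linear _ -> _}) x)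
    = f (tensor_coef M t x).
  move: x; apply: (@tensor_ext _ _ _ _
    (tensor_coef N t \o tensor_map f (idfun : {linear _ -> _}))
    (f \o tensor_coef M t)) => m u.
  by rewrite /tensor_coef /= tensor_mapE !tensor_liftE linearZZ.
have [s sE] := tensor_coef_decomp y; have [s' sE'] := tensor_coef_decomp z.
rewrite (sE (undup (s ++ s'))) ?undup_uniq//; last first.
  by move=> t ts; rewrite mem_undup mem_cat ts.
rewrite (sE' (undup (s ++ s'))) ?undup_uniq//; last first.
  by move=> t ts; rewrite mem_undup mem_cat ts orbT.
apply: eq_bigr => t _; congr tens; apply: finj.
by rewrite -!coefE fyz.
Qed.

Lemma projective_flat P : projective P -> flat P.
Proof.
move=> projP M N f finj y z fyz.
have [s sE] := projP _ _ (free_cover P) idfun (@free_cover_surj P).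
have retr x : tensor_map (idfun : {linear M -> M}) (free_cover P)
    (tensor_map (idfun : {linear M -> M}) s x) = x.
  rewrite tensor_map_comp -[RHS]tensor_map_id.
  by apply: tensor_map_eq => // p; exact: sE.
rewrite -[y]retr -[z]retr; congr tensor_map; apply: (free_flat finj).
have swap x : tensor_map f (idfun : {linear _ -> _})
    (tensor_map (idfun : {linear M -> M}) s x)
    = tensor_map (idfun : {linear N -> N}) s
        (tensor_map f (idfun : {linear P -> P}) x).
  by rewrite !tensor_map_comp; exact: tensor_map_eq.
by rewrite !swap fyz.
Qed.

Lemma PC_FC (C X : lmodType R) : PC C X -> FC C X.
Proof. by case=> P [/projective_flat flatP XP]; exists P. Qed.

End Projective.

Section TorExt.
Variable R : comPzRingType.

(* Q chooses a proper resolution of every module. The functorial action uses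
   a chosen lift to these resolutions; lifts are unique up to homotopy. *)
Section RelativeTor.
Variables (cX : lmodType R -> Prop).
Variable Q : forall M : lmodType R, proper_resolution cX M.

Definition RTor (i : nat) (M N : lmodType R) : lmodType R :=
  homol i (tensor_complex (Q M) N).

Definition RTor_map (i : nat) (M M' N N' : lmodType R)
    (f : {linear M -> M'}) (g : {linear N -> N'}) :
    {linear RTor i M N -> RTor i M' N'} :=
  homol_map (tensor_chain
    (lift_chain f (resolution_in (Q M)) (@resolution_proper _ _ _ (Q M'))) g) i.

End RelativeTor.

Definition Tor (i : nat) (A B : lmodType R) : lmodType R :=
  RTor (@free_resolution R) i A B.

Definition Tor_map (i : nat) (A A' B B' : lmodType R)
    (f : {linear A -> A'}) (g : {linear B -> B'}) :
    {linear Tor i A B -> Tor i A' B'} :=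
  RTor_map (@free_resolution R) i f g.

(* The cohomology in degree i of Hom(P, B), with P a projective resolution
   of A. *)
Definition Ext (i : nat) (A B : lmodType R) : lmodType R :=
  let P := free_resolution A in
  homology (hom_pre (bd P i) : {linear {linear P i.-1 -> B} -> {linear P i -> B}})
    (hom_pre (diff P i)).

End TorExt.

Section Semidualizing.
Variable R : comPzRingType.

Definition finitely_generated (V : lmodType R) (S : submodClosed V) :=
  exists n (e : 'I_n -> V), (forall j, e j \in S) /\
    forall x, x \in S -> exists a : 'I_n -> R, x = \sum_j a j *: e j.

Definition noetherian := forall I : submodClosed R^o, finitely_generated I.

Definition fg_module (C : lmodType R) :=
  exists n (e : 'I_n -> C),
    forall x, exists a : 'I_n -> R, x = \sum_j a j *: e j.

Definition homothety (C : lmodType R) (r : R) : {linear C -> C} :=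
  r *: (idfun : {linear C -> C}).

Definition semidualizing (C : lmodType R) :=
  [/\ fg_module C, bijective (homothety C) &
      forall i, (1 <= i)%N -> forall x : Ext i C C, x = 0].

End Semidualizing.

Section Comparison.
Variables (R : comPzRingType) (C : lmodType R).
Variable Q : forall M : lmodType R, proper_resolution (PC C) M.
Variable G : forall M : lmodType R, proper_resolution (FC C) M.

Fact PC_proper M : is_proper (PC C) (G M).
Proof. by move=> A /PC_FC; exact: resolution_proper. Qed.

Definition rho (i : nat) (M N : lmodType R) : {linear RTor Q i M N -> RTor G i M N} :=
  homol_map (tensor_chain (lift_chain idfun (resolution_in (Q M)) (@PC_proper M)) idfun) i.

End Comparison.

Section NaturalIso.
Variables (R : comPzRingType) (F F' : lmodType R -> lmodType R -> lmodType R).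

Definition bifunctor_map (F : lmodType R -> lmodType R -> lmodType R) :=
  forall M M' N N' : lmodType R, {linear M -> M'} -> {linear N -> N'} ->
    {linear F M N -> F M' N'}.

Definition natural_iso (Fmap : bifunctor_map F) (F'map : bifunctor_map F')
    (eta : forall M N : lmodType R, {linear F M N -> F' M N}) :=
  (forall (M M' N N' : lmodType R) (f : {linear M -> M'})
      (g : {linear N -> N'}) (x : F M N),
     eta M' N' (Fmap M M' N N' f g x) = F'map M M' N N' f g (eta M N x)) /\
  (forall M N, bijective (eta M N)).

End NaturalIso.

(* Main.v *)
Require Import Defs.
From HB Require Import structures.
From mathcomp Require Import all_boot all_algebra.
From mathcomp Require Import boolp functions.
Set Implicit Arguments.
Unset Strict Implicit.
Unset Printing Implicit Defensive.
Import GRing.Theory.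
Local Open Scope ring_scope.

(** Applying Hom(C, -) turns relative resolutions by P_C or F_C into ordinary
    flat resolutions, and tensoring with C undoes this.

    Let F be flat. As R is noetherian, C has a finite presentation, so Hom(C, -)
    is the kernel of a map between finite powers and commutes with F ⊗ -;
    since R = Hom(C, C), this makes F -> Hom(C, F ⊗ C) bijective ([coev_bij]).
    A triangle identity then shows that the evaluation
    Hom(C, V) ⊗ (C ⊗ N) -> V ⊗ N is bijective whenever V is in F_C ([ev_bij]),
    and that Hom(C, V) is flat ([hom_FC_flat]).

    Let X be a proper resolution of M by P_C or by F_C. Its terms are in F_C,
    because projective modules are flat, and C itself lies in P_C, so properness
    makes Hom(C, X) an acyclic flat resolution of Hom(C, M). Evaluation
    identifies Hom(C, X) ⊗ (C ⊗ N) with X ⊗ N, so it remains to see that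
    Tor of Hom(C, M) can be computed from a flat resolution: a lift of the
    identity from a free resolution to a flat one is bijective on homology with
    any coefficients B ([lift_homology_bij]), and any two lifts of the same map
    agree there ([lift_homology_eq]). Both are proved by induction on the degree,
    for all B at once: a presentation 0 -> J -> L -> B -> 0 with L free gives a
    short exact sequence of complexes whose middle term has no homology in
    positive degrees, which moves the claim for B down to the claims for J and L.

    The result is an isomorphism
    Tor_i(Hom(C, M), C ⊗ N) -> H_i(X ⊗ N), natural with respect to every chain
    map X -> X' that lifts a map M -> M' ([tor_eval_natural]). Its instance for
    F_C-resolutions is the second isomorphism, the inverse of its instance for
    P_C-resolutions is the first, and naturality with respect to the comparison
    map Q -> G says that rho is the composite of the two. *)

(** * Right exactness of the tensor product, and flatness *)

Definition exact_at (R : pzRingType) (A B D : lmodType R)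
    (f : {linear A -> B}) (g : {linear B -> D}) :=
  forall y, g y = 0 -> exists x, f x = y.

Definition onto (A B : Type) (g : A -> B) := forall y, exists x, g x = y.

Lemma inj_onto_bij (U V : Type) (f : U -> V) : injective f -> onto f -> bijective f.
Proof.
move=> finj fonto; pose g y := projT1 (cid (fonto y)).
have gK y : f (g y) = y by exact: projT2 (cid (fonto y)).
by exists g => // x; apply: finj; rewrite gK.
Qed.

Section Inverse.
Variables (R : pzRingType) (U V : lmodType R).

Lemma linear_injective (f : {linear U -> V}) :
  (forall x, f x = 0 -> x = 0) -> injective f.
Proof.
move=> f0 x y fxy; apply/eqP; rewrite -subr_eq0; apply/eqP/f0.
by rewrite linearB fxy subrr.
Qed.

Lemma linear_inverse (f : {linear U -> V}) : bijective f ->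
  exists g : {linear V -> U}, cancel f g /\ cancel g f.
Proof.
case=> g fK gK.
have lg : linear g.
  by move=> a x y; apply: (can_inj fK); rewrite linearP !gK.
pose gL : {linear V -> U} := HB.pack g (GRing.isLinear.Build R V U *:%R g lg).
by exists gL.
Qed.

End Inverse.

Section TensorTheory.
Variable R : comPzRingType.
Implicit Types A B D M N P V : lmodType R.

Definition swap M N : {linear M ⊗ N -> N ⊗ M} :=
  tensor_lift (b := fun m n => tens n m)
    (fun n => linearP (tens n)) (fun m => @tens_linear_l R N M m).

Lemma swapE M N (m : M) (n : N) : swap M N (tens m n) = tens n m.
Proof. exact: tensor_liftE. Qed.

Lemma swapK M N : cancel (swap M N) (swap N M).
Proof.
by apply: (@tensor_ext _ _ _ _ (swap N M \o swap M N) idfun) => m n /=; rewrite !swapE.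
Qed.

Lemma swap_map A B M N (f : {linear A -> B}) (g : {linear M -> N}) x :
  swap B N (tensor_map f g x) = tensor_map g f (swap A M x).
Proof.
move: x; apply: (@tensor_ext _ _ _ _ (swap B N \o tensor_map f g)
  (tensor_map g f \o swap A M)) => m n /=.
by rewrite tensor_mapE !swapE tensor_mapE.
Qed.

Lemma tensor_map_bij A B M N (f : {linear A -> B}) (g : {linear M -> N}) :
  bijective f -> bijective g -> bijective (tensor_map f g).
Proof.
move=> /linear_inverse[f' [fK f'K]] /linear_inverse[g' [gK g'K]].
by exists (tensor_map f' g') => x; rewrite tensor_map_comp -[RHS]tensor_map_id;
  apply: tensor_map_eq.
Qed.

Lemma tensor_map_onto A B N (f : {linear A -> B}) :
  onto f -> onto (tensor_map f (idfun : {linear N -> N})).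
Proof.
move=> fonto; elim/tensor_ind=> [b n|y y' [x <-] [x' <-]].
  by have [a <-] := fonto b; exists (tens a n); rewrite tensor_mapE.
by exists (x + x'); rewrite linearD.
Qed.

(** Right exactness: a choice of preimages under [g] is bilinear modulo the
    image of [f ⊗ N], so it defines an inverse on D ⊗ N of the map induced
    by [g ⊗ N] on the cokernel. *)
Lemma tensor_right_exact A B D N (f : {linear A -> B}) (g : {linear B -> D}) :
  (forall x, g (f x) = 0) -> exact_at f g -> onto g ->
  exact_at (tensor_map f (idfun : {linear N -> N}))
           (tensor_map g (idfun : {linear N -> N})).
Proof.
move=> gf fg gonto y gy0.
pose I := im (tensor_map f (idfun : {linear N -> N})).
pose s d := projT1 (cid (gonto d)).
have sK d : g (s d) = d by exact: projT2 (cid (gonto d)).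
have piE b b' n : g b = g b' -> quo_pi I (tens b n) = quo_pi I (tens b' n).
  move=> gbb; apply/quo_piP; apply/imP.
  have /fg[a fa] : g (b - b') = 0 by rewrite linearB gbb subrr.
  exists (tens a n); rewrite [LHS]tensor_mapE fa tensDl; congr (_ + _).
  by rewrite -scaleN1r tensZl scaleN1r.
have bl n : linear (fun d => quo_pi I (tens (s d) n)).
  move=> a d d'; rewrite -linearP -tens_linear_l; apply: piE.
  by rewrite linearP !sK.
have br d : linear (fun n => quo_pi I (tens (s d) n)).
  by move=> a n n'; rewrite -!linearP.
have liftK : tensor_lift bl br \o tensor_map g (idfun : {linear N -> N})
    =1 quo_pi I.
  apply: tensor_ext => b n /=; rewrite tensor_mapE tensor_liftE.
  by apply: piE; rewrite sK.
apply/(imP (tensor_map f (idfun : {linear N -> N})) y)/(quo_pi0P I).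
by rewrite -liftK /= gy0 !linear0.
Qed.

(** Flatness is stated for injections only; factoring [g] through its image
    separates a right exact part from an injection. *)
Lemma flat_exact A B D P (f : {linear A -> B}) (g : {linear B -> D}) :
  flat P -> (forall x, g (f x) = 0) -> exact_at f g ->
  exact_at (tensor_map f (idfun : {linear P -> P}))
           (tensor_map g (idfun : {linear P -> P})).
Proof.
move=> flatP gf fg y gy0.
have gI b : g b \in im g by apply/imP; exists b.
pose g' : {linear B -> submod_of (im g)} := corestr gI.
have gonto : onto g'.
  move=> z; have /imP[b gb] := valP z; exists b; exact: val_inj.
have inj_val : injective (val : {linear submod_of (im g) -> D}).
  exact: val_inj.
apply: (tensor_right_exact (g := g')) => //.
- by move=> x; apply: val_inj; exact: gf.
- by move=> b /(congr1 val); exact: fg.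
apply: (flatP _ _ _ inj_val); rewrite linear0 tensor_map_comp -[RHS]gy0.
exact: tensor_map_eq.
Qed.

Lemma flat_injr P A B (f : {linear A -> B}) : flat P -> injective f ->
  injective (tensor_map (idfun : {linear P -> P}) f).
Proof.
move=> flatP finj x y /(congr1 (swap P B)); rewrite !swap_map => /(flatP _ _ _ finj).
exact: (can_inj (@swapK P A)).
Qed.

Lemma exact_swap A B D P (f : {linear A -> B}) (g : {linear B -> D}) :
  exact_at (tensor_map f (idfun : {linear P -> P}))
           (tensor_map g (idfun : {linear P -> P})) ->
  exact_at (tensor_map (idfun : {linear P -> P}) f)
           (tensor_map (idfun : {linear P -> P}) g).
Proof.
move=> fg y /(congr1 (swap P D)); rewrite swap_map linear0 => /fg[x xy].
by exists (swap A P x); rewrite /= -swap_map xy swapK.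
Qed.

Lemma tensor_map_ontor P A B (f : {linear A -> B}) :
  onto f -> onto (tensor_map (idfun : {linear P -> P}) f).
Proof.
move=> fonto y; have [x xy] := tensor_map_onto (N := P) fonto (swap P B y).
by exists (swap A P x); rewrite /= -swap_map xy swapK.
Qed.

Lemma flat_iso P P' (f : {linear P -> P'}) : bijective f -> flat P -> flat P'.
Proof.
move=> bf flatP M N h hinj.
have [f' [fK f'K]] := linear_inverse bf.
have [k kK _] : bijective (tensor_map (idfun : {linear M -> M}) f').
  by apply: tensor_map_bij; [exists id|exists f].
apply: (inj_compr (f := tensor_map (idfun : {linear N -> N}) f')) => x y /=.
rewrite !tensor_map_comp => xy; apply: (can_inj kK); apply: (flatP _ _ _ hinj).
by rewrite !tensor_map_comp; exact: xy.
Qed.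

End TensorTheory.

Section Unit.
Variables (R : comPzRingType) (V : lmodType R).

Definition scalar_map (v : V) (r : R^o) : V := r *: v.
Fact scalar_map_linear v : linear (scalar_map v).
Proof. by move=> a r s; rewrite /scalar_map scalerDl scalerA. Qed.
HB.instance Definition _ v :=
  GRing.isLinear.Build R R^o V *:%R (scalar_map v) (scalar_map_linear v).

Lemma scalar_map_linearr r : linear (fun v => scalar_map v r).
Proof. by move=> a v w; rewrite /scalar_map scalerDr !scalerA mulrC. Qed.

Definition unit_tensor (v : V) : R^o ⊗ V := tens (1 : R^o) v.

Lemma unit_tensor_linear : linear unit_tensor.
Proof. exact: linearP. Qed.
HB.instance Definition _ :=
  GRing.isLinear.Build R V (R^o ⊗ V) *:%R unit_tensor unit_tensor_linear.

Lemma unit_tensor_bij : bijective unit_tensor.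
Proof.
pose h : {linear R^o ⊗ V -> V} := tensor_lift
  (b := fun r v => scalar_map v r) scalar_map_linear scalar_map_linearr.
exists h => [v|]; first by rewrite /h /= tensor_liftE /scalar_map scale1r.
apply: (@tensor_ext _ _ _ _ (unit_tensor \o h) idfun) => r v.
rewrite /h /= tensor_liftE /unit_tensor /scalar_map linearZZ -tensZl.
by rewrite /GRing.scale /= mulr1.
Qed.

End Unit.

Lemma regular_projective (R : comPzRingType) : projective (R^o : lmodType R).
Proof.
move=> M N g f gonto; have [m gm] := gonto (f (1 : R^o)).
exists (scalar_map m) => r.
by rewrite /= /scalar_map linearZZ gm -linearZZ /GRing.scale /= mulr1.
Qed.

Lemma PC_self (R : comPzRingType) (C : lmodType R) : PC C C.
Proof.
exists (R^o : lmodType R); split; first exact: regular_projective.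
by exists (@unit_tensor R C); exact: unit_tensor_bij.
Qed.

(** * Submodules of R^n over a noetherian ring *)

Section Noetherian.
Variable R : comPzRingType.

(** Dévissage: generators of the image [I] of [S], lifted to [S], together with
    generators of the kernel [T] generate [S]. *)
Lemma fg_extension (V W : lmodType R) (f : {linear V -> W}) (S T : submodClosed V)
    (I : submodClosed W) :
  (forall x, x \in S -> f x \in I) ->
  (forall y, y \in I -> exists2 x, x \in S & f x = y) ->
  (forall x, x \in T <-> x \in S /\ f x = 0) ->
  finitely_generated I -> finitely_generated T -> finitely_generated S.
Proof.
move=> SI IS TE [m [y [yI ygen]]] [n [z [zT zgen]]].
have yS i : exists x, x \in S /\ f x = y i.
  by have [x xS fx] := IS _ (yI i); exists x.
pose x i := projT1 (cid (yS i)).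
have [xS fx] : (forall i, x i \in S) /\ (forall i, f (x i) = y i).
  by split=> i; have [] := projT2 (cid (yS i)).
exists (m + n)%N, (fun j => match fintype.split j with inl i => x i | inr k => z k end).
split=> [j|v vS].
  by case: fintype.split => [i|k] //; have [] := (TE (z k)).1 (zT k).
have [a fv] := ygen _ (SI _ vS).
have /zgen[b vb] : v - \sum_i a i *: x i \in T.
  apply/TE; split.
    by rewrite rpredD// submodN rpred_sum// => i _; rewrite rpredZ.
  rewrite linearB linear_sum fv; apply/eqP; rewrite subr_eq0; apply/eqP.
  by apply: eq_bigr => i _; rewrite linearZZ fx.
exists (fun j => match fintype.split j with inl i => a i | inr k => b k end).
rewrite big_split_ord /= -[LHS](subrK (\sum_i a i *: x i)) vb [LHS]addrC.
congr (_ + _); apply: eq_bigr => i _.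
  by have /= -> := unsplitK (inl i : 'I_m + 'I_n).
by have /= -> := unsplitK (inr i : 'I_m + 'I_n).
Qed.

Definition fun_proj (n : nat) (V : lmodType R) (j : 'I_n) (x : 'I_n -> V) : V := x j.
Fact fun_proj_linear n (V : lmodType R) (j : 'I_n) : linear (@fun_proj n V j).
Proof. by []. Qed.
HB.instance Definition _ n (V : lmodType R) (j : 'I_n) :=
  GRing.isLinear.Build R ('I_n -> V) V *:%R (@fun_proj n V j) (@fun_proj_linear n V j).

Definition fun_inj n (V : lmodType R) (j : 'I_n) (v : V) : 'I_n -> V :=
  fun k => if k == j then v else 0.
Fact fun_inj_linear n (V : lmodType R) (j : 'I_n) : linear (@fun_inj n V j).
Proof.
move=> a v w; apply/funext => k; rewrite addrfctE scalrfctE /fun_inj.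
by case: eqP => // _; rewrite scaler0 addr0.
Qed.
HB.instance Definition _ n (V : lmodType R) (j : 'I_n) :=
  GRing.isLinear.Build R V ('I_n -> V) *:%R (@fun_inj n V j) (@fun_inj_linear n V j).

Lemma sum_fun_inj n (V : lmodType R) (x : 'I_n -> V) :
  x = \sum_j fun_inj j (fun_proj j x).
Proof.
apply/funext => k; rewrite fct_sumE (bigD1 k)//= big1 ?addr0.
  by rewrite /fun_inj /fun_proj eqxx.
by move=> j jk; rewrite /fun_inj eq_sym (negPf jk).
Qed.

(** Induction on the number [k] of coordinates that may be nonzero on the
    submodule; projecting to the last of them has an ideal as its image, and a
    kernel with one coordinate fewer. *)
Lemma noetherian_free n (S : submodClosed ('I_n -> R^o)) :
  noetherian R -> finitely_generated S.
Proof.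
move=> hR.
have step k : forall S : submodClosed ('I_n -> R^o),
    (forall x, x \in S -> forall j : 'I_n, (k <= j)%N -> x j = 0) ->
    finitely_generated S.
  elim: k => [|k IHk] {}S Sk.
    exists 0, (fun _ => 0); split=> [[]//|x xS]; exists (fun _ => 0).
    by rewrite big_ord0; apply/funext => j; exact: Sk.
  have [kn|nk] := ltnP k n; last first.
    apply: IHk => x xS j kj; have := ltn_ord j.
    by rewrite ltnNge (leq_trans nk kj).
  pose f : {linear ('I_n -> R^o) -> R^o} := fun_proj (Ordinal kn).
  pose I : submodClosed R^o := im (f \o val : {linear submod_of S -> R^o}).
  pose K := ker (f \o val : {linear submod_of S -> R^o}).
  pose T : submodClosed ('I_n -> R^o) :=
    im (val \o val : {linear submod_of K -> _}).
  have TE x : x \in T <-> x \in S /\ f x = 0.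
    split=> [/imP[[[y yS] /= fy] <-]|[xS fx]].
      by split=> //; exact: (kerP _ _ fy).
    have xk : (exist (fun x => x \in S) x xS : submod_of S) \in K by apply/kerP.
    by apply/imP; exists (exist (fun y => y \in K) _ xk).
  apply: (@fg_extension _ _ f S T I) => //.
  - by move=> x xS; apply/imP; exists (exist _ x xS).
  - by move=> y /imP[[x xS] <-]; exists x.
  apply: IHk => x /TE[xS fx] j; rewrite leq_eqVlt => /orP[/eqP kj|]; last exact: Sk.
  by rewrite -fx /f /= /fun_proj; congr x; apply: val_inj.
by apply: (step n) => x _ j; rewrite leqNgt ltn_ord.
Qed.

End Noetherian.

(** * Finite presentations, and Hom(C, F ⊗ C) for F flat *)

Section Combination.
Variables (R : comPzRingType) (n : nat) (V : lmodType R) (v : 'I_n -> V).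

Definition comb (a : 'I_n -> R^o) : V := \sum_j a j *: v j.
Fact comb_linear : linear comb.
Proof.
move=> r a b; rewrite /comb scaler_sumr -big_split; apply: eq_bigr => j _ /=.
by rewrite scalerA -scalerDl.
Qed.
HB.instance Definition _ :=
  GRing.isLinear.Build R ('I_n -> R^o) V *:%R comb comb_linear.

Lemma comb_basis j : comb (fun_inj j (1 : R^o)) = v j.
Proof.
rewrite /comb (bigD1 j)//= big1 ?addr0; last first.
  by move=> k kj; rewrite /fun_inj (negPf kj) scale0r.
by rewrite /fun_inj eqxx scale1r.
Qed.

End Combination.

Lemma comb_map (R : comPzRingType) n (V W : lmodType R) (f : {linear V -> W})
  (v : 'I_n -> V) a : f (comb v a) = comb (f \o v) a.
Proof. by rewrite linear_sum; apply: eq_bigr => j _; rewrite linearZZ. Qed.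

Lemma comb_linearr (R : comPzRingType) n (V : lmodType R) (a : 'I_n -> R^o) :
  linear (fun v : 'I_n -> V => comb v a).
Proof.
move=> r v w; rewrite /comb scaler_sumr -big_split; apply: eq_bigr => j _ /=.
rewrite [X in _ *: X = _](_ : _ = r *: v j + w j)//.
by rewrite scalerDr !scalerA mulrC.
Qed.

Section Presentation.
Variables (R : comPzRingType) (C : lmodType R) (n m : nat).
Variables (e : 'I_n -> C) (k : 'I_m -> 'I_n -> R^o).
Hypotheses (egen : onto (comb e)) (kgen : exact_at (comb k) (comb e)).

Lemma presentation_ext (V : lmodType R) (f g : {linear C -> V}) :
  (forall j, f (e j) = g (e j)) -> f =1 g.
Proof.
move=> fg x; have [a <-] := egen x; rewrite !comb_map.
by apply: eq_bigr => j _; rewrite /= fg.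
Qed.

Lemma presentation_lift (V : lmodType R) (v : 'I_n -> V) :
  (forall l, comb v (k l) = 0) ->
  exists h : {linear C -> V}, forall j, h (e j) = v j.
Proof.
move=> vk; pose s x := projT1 (cid (egen x)).
have sK x : comb e (s x) = x by exact: projT2 (cid (egen x)).
have wd a b : comb e a = comb e b -> comb v a = comb v b.
  move=> ab; have /kgen[c ckab] : comb e (a - b) = 0.
    by rewrite linearB /= ab subrr.
  apply/eqP; rewrite -subr_eq0 -linearB -ckab linear_sum.
  by rewrite big1// => l _; rewrite linearZZ /= vk scaler0.
have lh : linear (fun x => comb v (s x)).
  by move=> a x y; rewrite -[RHS]linearP; apply: wd; rewrite [RHS]linearP /= !sK.
pose h : {linear C -> V} :=
  HB.pack (fun x => comb v (s x)) (GRing.isLinear.Build R C V *:%R _ lh).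
exists h => j; rewrite /h /= -[RHS](comb_basis v); apply: wd.
by rewrite sK comb_basis.
Qed.

End Presentation.

Lemma finite_presentation (R : comPzRingType) (C : lmodType R) :
  noetherian R -> fg_module C -> exists n m (e : 'I_n -> C) (k : 'I_m -> 'I_n -> R^o),
    [/\ onto (comb e), forall l, comb e (k l) = 0 & exact_at (comb k) (comb e)].
Proof.
move=> hR [n [e egen]].
have [m [k [kS kgen]]] := noetherian_free (ker (comb e)) hR.
exists n, m, e, k; split=> [x|l|a /kerP/kgen[b ->]].
- by have [a ->] := egen x; exists a.
- exact/kerP.
- by exists b.
Qed.

Section Unit.
Variables (R : comPzRingType) (C : lmodType R).

Definition coev (F : lmodType R) (f : F) : {linear C -> F ⊗ C} := tens f.

Fact coev_linear F : linear (@coev F).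
Proof. by move=> a f g; apply: linear_ext => c; exact: tens_linear_l. Qed.
HB.instance Definition _ F :=
  GRing.isLinear.Build R F {linear C -> F ⊗ C} *:%R (@coev F) (@coev_linear F).

(** In terms of generators [e] and relations [k] of C, a map C -> V is a family
    of values in V^n killed by [w : V^n -> V^m]. Bijectivity of the homothety
    map says that 0 -> R -> C^n -> C^m is exact. Tensoring with F keeps it exact
    and yields the same sequence with R replaced by F and C by F ⊗ C. *)
Lemma coev_bij F : noetherian R -> fg_module C -> bijective (homothety C) ->
  flat F -> bijective (@coev F).
Proof.
move=> hR fgC hC flatF.
have [n [m [e [k [egen ke kgen]]]]] := finite_presentation hR fgC.
have lu : linear (fun (r : R^o) (j : 'I_n) => r *: e j).
  by move=> a r s; apply/funext => j; rewrite scalerDl -scalerA.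
pose u : {linear R^o -> ('I_n -> C)} :=
  HB.pack (fun r j => r *: e j) (GRing.isLinear.Build R R^o ('I_n -> C) *:%R _ lu).
have lw : linear (fun (c : 'I_n -> C) (l : 'I_m) => comb c (k l)).
  by move=> a c d; apply/funext => l; exact: comb_linearr.
pose w : {linear ('I_n -> C) -> ('I_m -> C)} :=
  HB.pack (fun c l => comb c (k l))
    (GRing.isLinear.Build R ('I_n -> C) ('I_m -> C) *:%R _ lw).
have wu x : w (u x) = 0.
  apply/funext => l; transitivity (x *: comb e (k l)); last by rewrite ke scaler0.
  exact: esym (comb_map (x *: (idfun : {linear C -> C})) e (k l)).
(* A family of values killed by the relations is an endomorphism of C. *)
have uw : exact_at u w.
  move=> c wc0.
  have [|h hE] := presentation_lift egen kgen (v := c).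
    by move=> l; exact: (congr1 (fun x => x l) wc0).
  have [g _ gK] := hC; exists (g h); apply/funext => j.
  by rewrite -hE -{2}(gK h).
have uinj : injective u.
  move=> r s urs; apply: (bij_inj hC); apply: linear_ext.
  apply: (presentation_ext egen) => j.
  exact: (congr1 (fun x => x j) urs).
have piE p (T : F ⊗ ('I_p -> C)) : T =
    \sum_j tensor_map (idfun : {linear F -> F}) (@fun_inj R p C j)
      (tensor_map (idfun : {linear F -> F}) (@fun_proj R p C j) T).
  elim/tensor_ind: T => [f c|x y xE yE].
    rewrite {1}(sum_fun_inj c) linear_sum; apply: eq_bigr => j _.
    by rewrite !tensor_mapE.
  by rewrite {1}xE {1}yE -big_split; apply: eq_bigr => j _ /=; rewrite !linearD.
have piu j (f : F) (r : R) : tensor_map (idfun : {linear F -> F}) (@fun_proj R n C j)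
    (tensor_map (idfun : {linear F -> F}) u (tens f (r : R^o))) = tens (r *: f) (e j).
  by rewrite !tensor_mapE /= /fun_proj tensZr tensZl.
apply: inj_onto_bij => [|y].
  apply: linear_injective => f f0.
  have /(flat_injr flatF uinj) : tensor_map
      (idfun : {linear F -> F}) u (tens f (1 : R^o)) =
      tensor_map (idfun : {linear F -> F}) u 0.
    rewrite linear0 [LHS]piE big1// => j _; rewrite piu scale1r.
    have /= -> := congr1 (fun h : {linear C -> F ⊗ C} => h (e j)) f0.
    by rewrite linear0.
  move=> /(congr1 (swap F R^o)); rewrite swapE linear0 => f10.
  by apply: (bij_inj (@unit_tensor_bij R F)); rewrite linear0.
(* The values of [y] on the generators, as one element of F ⊗ C^n. *)
pose T := \sum_j tensor_map (idfun : {linear F -> F}) (@fun_inj R n C j) (y (e j)).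
have projT j : tensor_map (idfun : {linear F -> F}) (@fun_proj R n C j) T = y (e j).
  rewrite linear_sum (bigD1 j)//= big1 ?addr0; last first.
    move=> i ij; rewrite tensor_map_comp.
    elim/tensor_ind: (y (e i)) => [f c|a b aE bE]; last first.
      by rewrite linearD [X in X + _]aE [X in _ + X]bE addr0.
    by rewrite tensor_mapE /= /fun_proj /fun_inj eq_sym (negPf ij) linear0.
  rewrite tensor_map_comp -[RHS]tensor_map_id; apply: tensor_map_eq => // c.
  by rewrite /= /fun_proj /fun_inj eqxx.
have : tensor_map (idfun : {linear F -> F}) w T = 0.
  rewrite [LHS]piE big1// => l _.
  have -> : tensor_map (idfun : {linear F -> F}) (@fun_proj R m C l)
      (tensor_map (idfun : {linear F -> F}) w T) = comb (y \o e) (k l).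
    under [RHS]eq_bigr => j _ do rewrite /= -projT.
    move: T {projT}; apply: tensor_ind => [f c|a b aE bE].
      rewrite !tensor_mapE /= {1}/fun_proj /= /comb linear_sum.
      by apply: eq_bigr => j _; rewrite tensor_mapE linearZZ.
    rewrite !linearD [X in X + _]aE [X in _ + X]bE -big_split.
    by apply: eq_bigr => j _; rewrite /= linearD scalerDr.
  by rewrite -comb_map ke !linear0.
case/(exact_swap (flat_exact flatF wu uw)) => x xT.
have [f fx] : exists f, tens f (1 : R^o) = x.
  elim/tensor_ind: x {xT} => [f r|a b [f <-] [g <-]].
    by exists (r *: f); rewrite tensZl -tensZr /GRing.scale /= mulr1.
  by exists (f + g); rewrite tensDl.
exists f; apply: linear_ext; apply: (presentation_ext egen) => j.
by rewrite -projT -xT -fx piu scale1r.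
Qed.

End Unit.

(** * The evaluation map *)

Section Evaluation.
Variables (R : comPzRingType) (C : lmodType R).
Implicit Types (F N V : lmodType R).

Lemma tensor_map_linearl V N (t : C ⊗ N) :
  linear (fun h : {linear C -> V} => tensor_map h (idfun : {linear N -> N}) t).
Proof.
move=> a h k; elim/tensor_ind: t => [c n|x y xE yE].
  by rewrite !tensor_mapE /= tens_linear_l.
by rewrite !linearD [X in X + _]xE [X in _ + X]yE ?scalerDr addrACA.
Qed.

Definition ev V N (x : {linear C -> V} ⊗ (C ⊗ N)) : V ⊗ N :=
  tensor_lift (@tensor_map_linearl V N) (fun h => linearP (tensor_map h idfun)) x.
Fact ev_linear V N : linear (@ev V N).
Proof. exact: linearP. Qed.
HB.instance Definition _ V N := GRing.isLinear.Build R
  ({linear C -> V} ⊗ (C ⊗ N)) (V ⊗ N) *:%R (@ev V N) (@ev_linear V N).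

Lemma evE V N h c n : @ev V N (tens h (tens c n)) = tens (h c) n.
Proof. by rewrite /ev tensor_liftE tensor_mapE. Qed.

Lemma tensor3_ext A B D V (f g : {linear A ⊗ (B ⊗ D) -> V}) :
  (forall a b d, f (tens a (tens b d)) = g (tens a (tens b d))) -> f =1 g.
Proof.
move=> fg; apply: tensor_ext => a; elim/tensor_ind => // x y xE yE.
by rewrite !tensDr !linearD [X in X + _]xE [X in _ + X]yE.
Qed.

Lemma ev_natural V V' N N' (f : {linear V -> V'}) (g : {linear N -> N'}) x :
  @ev V' N' (tensor_map (hom_post f) (tensor_map (idfun : {linear C -> C}) g) x)
  = tensor_map f g (@ev V N x).
Proof.
move: x; apply: (@tensor3_ext _ _ _ _
  (@ev V' N' \o tensor_map (hom_post f) (tensor_map (idfun : {linear C -> C}) g))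
  (tensor_map f g \o @ev V N)) => h c n /=.
by rewrite !tensor_mapE /= !evE !tensor_mapE /= evE.
Qed.

Section Assoc.
Variables F N : lmodType R.

Definition tens_at (n : N) : {linear C -> C ⊗ N} := swap N C \o tens n.

Lemma assoc_linearl n : linear (tensor_map (idfun : {linear F -> F}) (tens_at n)).
Proof. exact: linearP. Qed.
Lemma assoc_linearr (t : F ⊗ C) :
  linear (fun n => tensor_map (idfun : {linear F -> F}) (tens_at n) t).
Proof.
move=> a n n'; elim/tensor_ind: t => [f c|x y xE yE].
  by rewrite !tensor_mapE /= !swapE !linearP.
by rewrite !linearD [X in X + _]xE [X in _ + X]yE ?scalerDr addrACA.
Qed.

Definition assoc (x : (F ⊗ C) ⊗ N) : F ⊗ (C ⊗ N) :=
  tensor_lift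
    (b := fun t n => tensor_map (idfun : {linear F -> F}) (tens_at n) t)
    assoc_linearl assoc_linearr x.
Fact assoc_linear : linear assoc.
Proof. exact: linearP. Qed.
HB.instance Definition _ := GRing.isLinear.Build R
  ((F ⊗ C) ⊗ N) (F ⊗ (C ⊗ N)) *:%R assoc assoc_linear.

Lemma assocE f c n : assoc (tens (tens f c) n) = tens f (tens c n).
Proof. by rewrite /assoc tensor_liftE tensor_mapE /= swapE. Qed.

End Assoc.

(** The triangle identity of the adjunction between - ⊗ C and Hom(C, -),
    tensored with N: the composite is the associativity isomorphism. *)
Lemma ev_coev F N : bijective
  (@ev (F ⊗ C) N \o tensor_map (coev C (F := F)) (idfun : {linear C ⊗ N -> C ⊗ N})).
Proof.
exists (@assoc F N).
  apply: (@tensor3_ext _ _ _ _ (@assoc F N \o (@ev (F ⊗ C) N \o tensor_map _ _)) idfun).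
  by move=> f c n /=; rewrite tensor_mapE evE assocE.
apply: (@tensor_ext _ _ _ _ ((@ev (F ⊗ C) N \o tensor_map _ _) \o @assoc F N) idfun).
move=> t n; elim/tensor_ind: t => [f c|x y xE yE].
  by rewrite /= assocE tensor_mapE evE.
by rewrite tensDl !linearD [X in X + _]xE [X in _ + X]yE.
Qed.

Hypotheses (hR : noetherian R) (fgC : fg_module C) (hC : bijective (homothety C)).

Lemma hom_post_bij V V' (f : {linear V -> V'}) : bijective f ->
  bijective (hom_post f : {linear C -> V} -> {linear C -> V'}).
Proof.
move=> /linear_inverse[g [fK gK]].
by exists (hom_post g) => h; apply: linear_ext => x /=; rewrite ?fK ?gK.
Qed.

(** For V = F ⊗ C this follows from the triangle identity, where the other
    factor is bijective as F is flat; both sides are functors of V. *)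
Lemma ev_bij V N : FC C V -> bijective (@ev V N).
Proof.
case=> F [flatF [f fbij]].
have evF : bijective (@ev (F ⊗ C) N).
  have cbij : bijective (tensor_map (coev C (F := F)) (idfun : {linear C ⊗ N -> C ⊗ N})).
    by apply: tensor_map_bij; [exact: coev_bij|exists id].
  have [d dK Kd] := cbij.
  apply: (eq_bij (bij_comp (@ev_coev F N) (Bijective Kd dK))) => x /=.
  by rewrite Kd.
have idbij (W : lmodType R) : bijective (idfun : {linear W -> W}) by exists id.
have tbij := tensor_map_bij fbij (idbij N).
have hbij := tensor_map_bij (hom_post_bij fbij) (tensor_map_bij (idbij C) (idbij N)).
have [g gK Kg] := tbij.
apply: (eq_bij (bij_comp (Bijective Kg gK) (bij_comp evF hbij))) => x /=.
by rewrite ev_natural gK.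
Qed.

Lemma hom_FC_flat V : FC C V -> flat {linear C -> V}.
Proof.
case=> F [flatF [f fbij]].
have [g [fK gK]] := linear_inverse fbij.
apply: (@flat_iso _ F _ (hom_post g \o @coev R C F)) => //.
apply: bij_comp (coev_bij _ _ _ _) => //.
by apply: hom_post_bij; exists f.
Qed.

End Evaluation.

(** * Chain maps on homology, elementwise *)

Section ChainMaps.
Variable R : comPzRingType.
Implicit Types X Y Z : complex R.

Definition id_chain X : chain_map X X :=
  @ChainMap R X X (fun i => idfun) (fun _ _ => erefl).

Fact comp_chain_subproof X Y Z (psi : chain_map Y Z) (phi : chain_map X Y) i x :
  (psi i \o phi i) (diff X i x) = diff Z i ((psi i.+1 \o phi i.+1) x).
Proof. by rewrite /= !cmapP. Qed.
Definition comp_chain X Y Z (psi : chain_map Y Z) (phi : chain_map X Y) :=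
  ChainMap (comp_chain_subproof psi phi).

Definition homology_inj X Y (phi : chain_map X Y) i :=
  forall z, bd X i z = 0 -> (exists y, diff Y i y = phi i z) ->
  exists x, diff X i x = z.

Definition homology_onto X Y (phi : chain_map X Y) i :=
  forall z, bd Y i z = 0 ->
  exists x, bd X i x = 0 /\ exists y, diff Y i y = phi i x - z.

Definition homology_eq X Y (phi psi : chain_map X Y) i :=
  forall z, bd X i z = 0 -> exists y, diff Y i y = phi i z - psi i z.

Definition exact_deg X i := forall z, bd X i z = 0 -> exists x, diff X i x = z.

Lemma homol_mapE X Y (phi : chain_map X Y) i (z : cycles (bd X i)) :
  homol_map phi i (hclass (diff X i) z) =
  hclass (diff Y i) (cycles_map (@H_map_ker _ _ _ phi i) z).
Proof. exact: homology_mapE. Qed.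

Lemma hclass_eq X i (z w : cycles (bd X i)) :
  (exists x, diff X i x = cycle_val z - cycle_val w) ->
  hclass (diff X i) z = hclass (diff X i) w.
Proof.
move=> [x xzw]; apply/eqP; rewrite -subr_eq0 -linearB; apply/eqP/hclass_eq0.
by exists x.
Qed.

Lemma homol_map_bij X Y (phi : chain_map X Y) i :
  homology_inj phi i -> homology_onto phi i -> bijective (homol_map phi i).
Proof.
move=> phi_inj phi_onto; apply: inj_onto_bij.
  apply: linear_injective; elim/hclass_ind=> z.
  rewrite [LHS]homol_mapE => /hclass_eq0 zb; apply/hclass_eq0.
  by apply: phi_inj => //; apply/kerP; exact: valP.
elim/hclass_ind=> z; have [|x [xc [y yxz]]] := phi_onto (cycle_val z).
  by apply/kerP; exact: valP.
exists (hclass (diff X i) (exist (fun x => x \in ker (bd X i)) x (introT (kerP _ _) xc))).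
by rewrite homol_mapE; apply: hclass_eq; exists y.
Qed.

Lemma homol_map_eq X Y (phi psi : chain_map X Y) i :
  homology_eq phi psi i -> homol_map phi i =1 homol_map psi i.
Proof.
move=> phipsi; elim/hclass_ind=> z; rewrite !homol_mapE; apply: hclass_eq.
by apply: phipsi; apply/kerP; exact: valP.
Qed.

Lemma homol_map_comp X Y Z (psi : chain_map Y Z) (phi : chain_map X Y) i c :
  homol_map psi i (homol_map phi i c) = homol_map (comp_chain psi phi) i c.
Proof.
elim/hclass_ind: c => z; rewrite !homol_mapE; congr hclass; exact: val_inj.
Qed.

Lemma homol_map_ext X Y (phi psi : chain_map X Y) i :
  phi i =1 psi i -> homol_map phi i =1 homol_map psi i.
Proof.
by move=> eq_i; apply: homol_map_eq => z _; exists 0; rewrite linear0 eq_i subrr.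
Qed.

Lemma homol_map_id X (phi : chain_map X X) i :
  phi i =1 id -> homol_map phi i =1 id.
Proof.
move=> phi1; elim/hclass_ind=> z; rewrite homol_mapE; congr hclass.
by apply: val_inj; exact: phi1.
Qed.

Lemma homol_map_iso X Y (phi : chain_map X Y) i :
  (forall j, bijective (phi j)) -> bijective (homol_map phi i).
Proof.
move=> phib; apply: homol_map_bij => [z zc [y yz]|z zc].
  have [g gK Kg] := phib i.+1; exists (g y); apply: (bij_inj (phib i)).
  by rewrite cmapP Kg.
have [g gK Kg] := phib i; exists (g z); split; last first.
  by exists 0; rewrite Kg subrr linear0.
case: i z zc g gK Kg => //= i z zc g gK Kg; apply: (bij_inj (phib i)).
by rewrite cmapP Kg zc linear0.
Qed.

End ChainMaps.

(** * Dimension shifting along a short exact sequence of complexes *)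

Section DimensionShift.
Variable R : comPzRingType.

Record short_exact (X' X X'' : complex R) (a : chain_map X' X) (b : chain_map X X'') :=
  ShortExact {
    ses_inj : forall i, injective (a i);
    ses_comp : forall i x, b i (a i x) = 0;
    ses_exact : forall i, exact_at (a i) (b i);
    ses_onto : forall i, onto (b i) }.

Section Connecting.
Variables (X' X X'' : complex R) (a : chain_map X' X) (b : chain_map X X'').
Hypothesis sX : short_exact a b.

(** The connecting homomorphism, before passing to classes: [x'] is a cycle since
    [a] is injective and [a x'] is a boundary. *)
Lemma connecting i z : bd X'' i.+1 z = 0 ->
  exists x x', [/\ b i.+1 x = z, a i x' = diff X i x & bd X' i x' = 0].
Proof.
move=> zc; have [x xz] := ses_onto sX z.
have /(ses_exact sX)[x' x'x] : b i (diff X i x) = 0.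
  by rewrite cmapP xz; exact: zc.
exists x, x'; split=> //; case: i z zc x xz x' x'x => //= i z zc x xz x' x'x.
by apply: (ses_inj sX); rewrite linear0 cmapP x'x diffK.
Qed.

End Connecting.

Variables (X' X X'' : complex R) (a : chain_map X' X) (b : chain_map X X'').
Hypothesis sX : short_exact a b.
Variables (Y' Y Y'' : complex R) (a' : chain_map Y' Y) (b' : chain_map Y Y'').
Hypothesis sY : short_exact a' b'.

Section OneMap.
Variables (phi' : chain_map X' Y') (phi : chain_map X Y) (phi'' : chain_map X'' Y'').
Hypotheses (pa : forall i x, a' i (phi' i x) = phi i (a i x))
           (pb : forall i x, b' i (phi i x) = phi'' i (b i x)).

(** If the class of [z] dies in Y'', then that of [x'] dies in Y', hence in X';
    correcting [x] by the witness turns it into a cycle, which is a boundary. *)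
Lemma shift_inj i : exact_deg X i.+1 -> homology_inj phi' i ->
  homology_inj phi'' i.+1.
Proof.
move=> exX phi'inj z zc [y'' y''z].
have [x [x' [xz x'x x'c]]] := connecting sX zc.
have [y yy''] := ses_onto sY y''.
have /(ses_exact sY)[y' y'E] : b' i.+1 (phi i.+1 x - diff Y i.+1 y) = 0.
  by rewrite linearB pb xz cmapP yy'' y''z subrr.
have [|w' w'x'] := phi'inj _ x'c.
  exists y'; apply: (ses_inj sY).
  by rewrite pa x'x cmapP y'E linearB diffK subr0 -cmapP.
have /exX[w wE] : bd X i.+1 (x - a i.+1 w') = 0.
  by rewrite /= linearB -cmapP w'x' x'x subrr.
exists (b i.+2 w).
by rewrite -cmapP wE linearB (ses_comp sX) subr0.
Qed.

(** The class of the connecting cycle [y'] of [z] comes from a cycle [x'] of X'.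
    Its image in X is a boundary of some [x], because it becomes one in Y; then
    [b x] is a cycle, and it maps to the class of [z]. *)
Lemma shift_onto i : exact_deg Y i.+1 -> homology_inj phi i ->
  homology_onto phi' i -> homology_onto phi'' i.+1.
Proof.
move=> exY phi_inj phi'onto z zc.
have [y [y' [yz y'y y'c]]] := connecting sY zc.
have [x' [x'c [w' w'E]]] := phi'onto _ y'c.
have [||x xx'] := phi_inj (a i x').
- exact: H_map_ker x'c.
- exists (y + a' i.+1 w').
  by rewrite linearD -cmapP w'E linearB pa y'y addrC subrK.
exists (b i.+1 x); split; first by rewrite /= -cmapP xx' (ses_comp sX).
have /exY[w wE] : bd Y i.+1 (phi i.+1 x - (y + a' i.+1 w')) = 0.
  rewrite /= linearB linearD -!cmapP xx' w'E linearB pa y'y.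
  by rewrite [X in _ - X]addrC subrK subrr.
exists (b' i.+2 w); rewrite -cmapP wE linearB linearD (ses_comp sY) addr0 yz pb.
by [].
Qed.

End OneMap.

Section TwoMaps.
Variables (phi' psi' : chain_map X' Y') (phi psi : chain_map X Y).
Variables (phi'' psi'' : chain_map X'' Y'').
Hypotheses (pa : forall i x, a' i (phi' i x) = phi i (a i x))
           (pb : forall i x, b' i (phi i x) = phi'' i (b i x)).
Hypotheses (qa : forall i x, a' i (psi' i x) = psi i (a i x))
           (qb : forall i x, b' i (psi i x) = psi'' i (b i x)).

(** The two lifts of [z] differ, up to the image of Y', by a cycle of Y, and
    such a cycle is a boundary. *)
Lemma shift_eq i : exact_deg Y i.+1 -> homology_eq phi' psi' i ->
  homology_eq phi'' psi'' i.+1.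
Proof.
move=> exY phipsi z zc; have [x [x' [xz x'x x'c]]] := connecting sX zc.
have [y' y'E] := phipsi _ x'c.
have /exY[w wE] : bd Y i.+1 (phi i.+1 x - psi i.+1 x - a' i.+1 y') = 0.
  by rewrite /= !linearB -!cmapP y'E linearB pa qa x'x subrr.
exists (b' i.+2 w).
by rewrite -cmapP wE !linearB (ses_comp sY) subr0 pb qb xz.
Qed.

End TwoMaps.

End DimensionShift.

(** * Homology of flat resolutions with coefficients *)

Section FlatResolutions.
Variable R : comPzRingType.
Implicit Types A B D M N : lmodType R.
Implicit Types X Y : complex R.

Definition flat_complex X := forall i, flat (X i).

Lemma tensor_map_comp0 A B D N (f : {linear A -> B}) (g : {linear B -> D}) :
  (forall x, g (f x) = 0) -> forall x,
  tensor_map (idfun : {linear N -> N}) g (tensor_map (idfun : {linear N -> N}) f x) = 0.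
Proof.
move=> gf; elim/tensor_ind=> [n a|x y xE yE].
  by rewrite !tensor_mapE /= gf linear0.
by rewrite !linearD [X in X + _]xE [X in _ + X]yE addr0.
Qed.

Definition coeff_chain X N N' (g : {linear N -> N'}) :
  chain_map (tensor_complex X N) (tensor_complex X N') := tensor_chain (id_chain X) g.

Lemma coeff_chain_natural X Y (phi : chain_map X Y) N N' (g : {linear N -> N'}) i x :
  coeff_chain Y g i (tensor_chain phi (idfun : {linear N -> N}) i x) =
  tensor_chain phi (idfun : {linear N' -> N'}) i (coeff_chain X g i x).
Proof. by rewrite /= !tensor_map_comp; exact: tensor_map_eq. Qed.

Section Coefficients.
Variable B : lmodType R.

Definition relations : lmodType R := submod_of (ker (free_cover B)).
Definition relation_val : {linear relations -> free_mod R B} := val.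

Lemma coeff_short_exact X : flat_complex X ->
  short_exact (coeff_chain X relation_val) (coeff_chain X (free_cover B)).
Proof.
move=> flatX.
have vJ x : free_cover B (relation_val x) = 0 by apply/kerP; exact: valP.
have exJ : exact_at relation_val (free_cover B).
  by move=> u /kerP uk; exists (exist (fun u => u \in ker (free_cover B)) u uk).
split=> i.
- exact: flat_injr (flatX i) val_inj.
- exact: tensor_map_comp0.
- exact: exact_swap (tensor_right_exact vJ exJ (@free_cover_surj R B)).
- exact: tensor_map_ontor (@free_cover_surj R B).
Qed.

End Coefficients.

Section Augmented.
Variables (M : lmodType R) (X : augmented M).
Hypothesis exX : acyclic (aug_complex X).

Lemma aug_onto : onto (aug X).
Proof. by move=> m; exact: (exX (i := 0)). Qed.

Lemma tensor_exact_deg N i : flat N -> exact_deg (tensor_complex X N) i.+1.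
Proof.
move=> flatN; apply: (flat_exact flatN); first exact: diffK.
exact: (exX (i := i.+2)).
Qed.

Lemma tensor_aug_exact N :
  exact_at (tensor_diff X N 0) (tensor_map (aug X) (idfun : {linear N -> N})).
Proof.
apply: tensor_right_exact; [exact: augK|exact: (exX (i := 1))|exact: aug_onto].
Qed.

Lemma tensor_augK N x :
  tensor_map (aug X) (idfun : {linear N -> N}) (tensor_diff X N 0 x) = 0.
Proof.
elim/tensor_ind: x => [a n|x y xE yE].
  by rewrite /= !tensor_mapE /= augK tens0l.
by rewrite !linearD [X in X + _]xE [X in _ + X]yE addr0.
Qed.

End Augmented.

(** In degree 0 the difference is killed by the augmentation, so it is a boundary
    by right exactness; in positive degrees the claim for B is shifted to the
    relations of B. Flatness plays the part that
    a homotopy between the lifts has for complexes of projectives. *)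
Lemma lift_homology_eq M M' (f : {linear M -> M'}) (P : augmented M) (G : augmented M')
    (phi psi : chain_map P G) :
  acyclic (aug_complex G) -> flat_complex P -> flat_complex G ->
  lifts f phi -> lifts f psi ->
  forall i B, homology_eq (tensor_chain phi (idfun : {linear B -> B}))
                          (tensor_chain psi idfun) i.
Proof.
move=> exG flatP flatG phif psif; elim=> [|i IHi] B.
  move=> z _; apply: (tensor_aug_exact exG).
  rewrite linearB /= !tensor_map_comp; apply/eqP; rewrite subr_eq0; apply/eqP.
  by apply: tensor_map_eq => // x /=; rewrite phif psif.
apply: (shift_eq (coeff_short_exact B flatP) (coeff_short_exact B flatG)
  (phi' := tensor_chain phi idfun) (psi' := tensor_chain psi idfun)
  (phi := tensor_chain phi idfun) (psi := tensor_chain psi idfun)).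
- by move=> j x; exact: coeff_chain_natural.
- by move=> j x; exact: coeff_chain_natural.
- by move=> j x; exact: coeff_chain_natural.
- by move=> j x; exact: coeff_chain_natural.
- exact (tensor_exact_deg exG (@free_flat R _)).
- exact: IHi.
Qed.

(** In degree 0 both sides are M ⊗ B. The step for B uses surjectivity for the
    relations of B, and injectivity for them and for the free cover. *)
Lemma lift_homology_bij M (P G : augmented M) (phi : chain_map P G) :
  acyclic (aug_complex P) -> acyclic (aug_complex G) ->
  flat_complex P -> flat_complex G -> lifts idfun phi ->
  forall i B, homology_inj (tensor_chain phi (idfun : {linear B -> B})) i /\
              homology_onto (tensor_chain phi (idfun : {linear B -> B})) i.
Proof.
move=> exP exG flatP flatG phi1.
have augE B x : tensor_map (aug G) (idfun : {linear B -> B})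
    (tensor_map (phi 0%N) (idfun : {linear B -> B}) x) =
    tensor_map (aug P) (idfun : {linear B -> B}) x.
  by rewrite tensor_map_comp; apply: tensor_map_eq.
elim=> [|i IHi] B.
  split=> [z _ [y yz]|z _].
    apply: (tensor_aug_exact exP); rewrite /= -augE -[RHS](tensor_augK y).
    by congr tensor_map; rewrite [RHS]yz.
  have [x xz] := tensor_map_onto (N := B) (aug_onto exP)
    (tensor_map (aug G) (idfun : {linear B -> B}) z).
  exists x; split=> //; apply: (tensor_aug_exact exG).
  by rewrite linearB /= augE xz subrr.
have sP := coeff_short_exact B flatP; have sG := coeff_short_exact B flatG.
have nat N N' (g : {linear N -> N'}) j x := coeff_chain_natural phi g (i := j) x.
have [[J1 J2] [L1 L2]] := (IHi (relations B), IHi (free_mod R B)).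
split.
  apply: (shift_inj sP sG (nat _ _ _) (nat _ _ _) _ J1).
  exact (tensor_exact_deg exP (@free_flat R _)).
apply: (shift_onto sP sG (nat _ _ _) (nat _ _ _) _ L1 J2).
exact (tensor_exact_deg exG (@free_flat R _)).
Qed.

End FlatResolutions.

(** * From Tor of Hom(C, M) to relative Tor *)

Section HomAugmented.
Variables (R : comPzRingType) (C : lmodType R).
Implicit Types (M N : lmodType R) (X Y : complex R).

Fact hom_augK M (X : augmented M) (h : hom_complex C X 1%N) :
  hom_post (aug X) (diff (hom_complex C X) 0%N h) = 0.
Proof. by apply: linear_ext => c; exact: augK. Qed.
Definition hom_aug M (X : augmented M) : augmented {linear C -> M} :=
  @Augmented R {linear C -> M} (hom_complex C X) (hom_post (aug X)) (@hom_augK M X).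

Lemma hom_aug_acyclic M (X : augmented M) :
  acyclic (hom_complex C (aug_complex X)) -> acyclic (aug_complex (hom_aug X)).
Proof. by move=> exX [|[|i]]; [exact: (exX 0)|exact: (exX 1)|exact: (exX i.+2)]. Qed.

Fact hom_chain_subproof X Y (phi : chain_map X Y) i (h : hom_complex C X i.+1) :
  hom_post (phi i) (diff (hom_complex C X) i h) =
  diff (hom_complex C Y) i (hom_post (phi i.+1) h).
Proof. by apply: linear_ext => c; exact: cmapP. Qed.
Definition hom_chain X Y (phi : chain_map X Y) :
    chain_map (hom_complex C X) (hom_complex C Y) :=
  @ChainMap R (hom_complex C X) (hom_complex C Y) (fun i => hom_post (phi i))
    (hom_chain_subproof phi).

Fact ev_chain_subproof X N i x :
  @ev R C (X i) N (diff (tensor_complex (hom_complex C X) (C ⊗ N)) i x) =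
  diff (tensor_complex X N) i (@ev R C (X i.+1) N x).
Proof.
rewrite /= -ev_natural; congr ev; apply: tensor_map_eq => // t.
by rewrite /= tensor_map_id.
Qed.
Definition ev_chain X N :
    chain_map (tensor_complex (hom_complex C X) (C ⊗ N)) (tensor_complex X N) :=
  @ChainMap R (tensor_complex (hom_complex C X) (C ⊗ N)) (tensor_complex X N)
    (fun i => @ev R C (X i) N) (@ev_chain_subproof X N).

Definition hom_lift M (X : augmented M) (exX : acyclic (hom_complex C (aug_complex X))) :
    chain_map (free_resolution {linear C -> M}) (hom_aug X) :=
  lift_chain idfun (resolution_in (free_resolution {linear C -> M}))
    (acyclic_proper (hom_aug_acyclic exX)).

Definition tor_eval i M (X : augmented M)
    (exX : acyclic (hom_complex C (aug_complex X))) N :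
    {linear Tor i {linear C -> M} (C ⊗ N) -> homol i (tensor_complex X N)} :=
  homol_map (ev_chain X N) i
  \o homol_map (tensor_chain (hom_lift exX) (idfun : {linear C ⊗ N -> C ⊗ N})) i.

Hypotheses (hR : noetherian R) (fgC : fg_module C) (hC : bijective (homothety C)).

Section Bijective.
Variables (M : lmodType R) (X : augmented M).
Hypotheses (FCX : forall i, FC C (X i)) (exX : acyclic (hom_complex C (aug_complex X))).

Lemma hom_aug_flat : flat_complex (hom_aug X).
Proof. by move=> i; exact: hom_FC_flat. Qed.

Lemma tor_eval_bij i N : bijective (tor_eval i exX N).
Proof.
have e_lifts : lifts idfun (hom_lift exX) by exact: liftP.
have [e_inj e_onto] := lift_homology_bij
  (@free_augmented_acyclic R {linear C -> M}) (hom_aug_acyclic exX)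
  (fun i => @free_flat R _) hom_aug_flat e_lifts i (C ⊗ N).
apply: bij_comp (homol_map_bij e_inj e_onto).
by apply: homol_map_iso => j; exact: ev_bij.
Qed.

End Bijective.

(** Both sides first change coefficients along C ⊗ g, then apply a lift of
    Hom(C, f) from the free resolution of Hom(C, M) to Hom(C, X'), then evaluate.
    The two lifts, [e' psi] and [Hom(C, phi) e], agree on homology. Stating this
    for arbitrary [phi] and [psi] covers both functoriality in M and the
    comparison of resolutions of different classes. *)
Lemma tor_eval_natural i M M' (X : augmented M) (X' : augmented M')
    (exX : acyclic (hom_complex C (aug_complex X)))
    (exX' : acyclic (hom_complex C (aug_complex X')))
    (f : {linear M -> M'}) (phi : chain_map X X')
    (psi : chain_map (free_resolution {linear C -> M}) (free_resolution {linear C -> M'}))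
    N N' (g : {linear N -> N'}) c :
  (forall i, FC C (X' i)) -> lifts f phi -> lifts (hom_post f) psi ->
  tor_eval i exX' N' (homol_map
    (tensor_chain psi (tensor_map (idfun : {linear C -> C}) g)) i c) =
  homol_map (tensor_chain phi g) i (tor_eval i exX N c).
Proof.
move=> FCX' phif psif.
set P := free_resolution {linear C -> M}.
set e := hom_lift exX; set e' := hom_lift exX'.
have eP : lifts idfun e by exact: liftP.
have e'P : lifts idfun e' by exact: liftP.
pose d : chain_map (tensor_complex P (C ⊗ N)) (tensor_complex P (C ⊗ N')) :=
  coeff_chain P (tensor_map (idfun : {linear C -> C}) g).
have -> : tor_eval i exX' N' (homol_map
    (tensor_chain psi (tensor_map (idfun : {linear C -> C}) g)) i c) =
  homol_map (ev_chain X' N') i (homol_map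
    (tensor_chain (comp_chain e' psi) (idfun : {linear C ⊗ N' -> C ⊗ N'})) i
    (homol_map d i c)).
  rewrite [LHS]/=; congr homol_map; rewrite !homol_map_comp.
  apply: homol_map_ext => x.
  by rewrite /= !tensor_map_comp; exact: tensor_map_eq.
have -> : homol_map (tensor_chain phi g) i (tor_eval i exX N c) =
  homol_map (ev_chain X' N') i (homol_map
    (tensor_chain (comp_chain (hom_chain phi) e) (idfun : {linear C ⊗ N' -> C ⊗ N'})) i
    (homol_map d i c)).
  rewrite /tor_eval [LHS]/= !homol_map_comp.
  apply: homol_map_ext => x.
  rewrite /= -ev_natural !tensor_map_comp.
  by congr ev; exact: tensor_map_eq.
congr homol_map; apply: homol_map_eq.
apply: (@lift_homology_eq _ _ _ (hom_post f) P (hom_aug X') (comp_chain e' psi)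
  (comp_chain (hom_chain phi) e)) => //.
- exact: hom_aug_acyclic.
- by move=> j; exact: free_flat.
- exact: hom_aug_flat.
- by move=> x; rewrite /= e'P psif.
move=> x; apply: linear_ext => y.
have := congr1 (fun h : {linear C -> M} => h y) (eP x).
move=> /= <-; exact: phif.
Qed.

End HomAugmented.

(** * Natural isomorphisms *)

Section NaturalIsoTheory.
Variables (R : comPzRingType) (F F' F'' : lmodType R -> lmodType R -> lmodType R).
Variables (Fmap : bifunctor_map F) (F'map : bifunctor_map F').
Variable F''map : bifunctor_map F''.

Lemma natural_iso_inverse (eta : forall M N, {linear F M N -> F' M N}) :
  natural_iso Fmap F'map eta ->
  exists theta : forall M N, {linear F' M N -> F M N}, natural_iso F'map Fmap theta.
Proof.
case=> etaN etaB; have inv M N := cid (linear_inverse (etaB M N)).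
pose theta M N := projT1 (inv M N).
have etaK M N : cancel (eta M N) (theta M N) by have [] := projT2 (inv M N).
have thetaK M N : cancel (theta M N) (eta M N) by have [] := projT2 (inv M N).
exists theta; split=> [M M' N N' f g x|M N].
  by apply: (bij_inj (etaB M' N')); rewrite etaN !thetaK.
by exists (eta M N); [exact: thetaK|exact: etaK].
Qed.

Lemma natural_iso_factor (eta : forall M N, {linear F M N -> F' M N})
    (zeta : forall M N, {linear F M N -> F'' M N})
    (theta : forall M N, {linear F' M N -> F'' M N}) :
  natural_iso Fmap F'map eta -> natural_iso Fmap F''map zeta ->
  (forall M N x, theta M N (eta M N x) = zeta M N x) ->
  natural_iso F'map F''map theta.
Proof.
move=> [etaN etaB] [zetaN zetaB] thetaE; split=> [M M' N N' f g x|M N].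
  have [eta' _ eta'K] := etaB M N.
  by rewrite -[x]eta'K -etaN !thetaE zetaN.
have [eta' etaK eta'K] := etaB M N.
apply: (eq_bij (bij_comp (zetaB M N) (Bijective eta'K etaK))) => x /=.
by rewrite -thetaE eta'K.
Qed.

End NaturalIsoTheory.

(** * Comparison of the relative Tor functors *)

Theorem theorem3p6 (R : comPzRingType) (hR : noetherian R)
  (C : lmodType R) (hC : semidualizing C)
  (Q : forall M : lmodType R, proper_resolution (PC C) M)
  (G : forall M : lmodType R, proper_resolution (FC C) M) (i : nat) :
  [/\ exists alpha : forall M N : lmodType R,
        {linear RTor Q i M N -> Tor i {linear C -> M} (C ⊗ N)},
        natural_iso (RTor_map Q i)
          (fun M M' N N' f g => Tor_map i (hom_post f)
            (tensor_map (idfun : {linear C -> C}) g)) alpha,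
      exists beta : forall M N : lmodType R,
        {linear Tor i {linear C -> M} (C ⊗ N) -> RTor G i M N},
        natural_iso
          (fun M M' N N' f g => Tor_map i (hom_post f)
            (tensor_map (idfun : {linear C -> C}) g)) (RTor_map G i) beta
    & natural_iso (RTor_map Q i) (RTor_map G i) (rho Q G i)].
Proof.
have [fgC homC _] := hC.
have FCQ M j : FC C (Q M j) by apply: PC_FC; exact: resolution_in.
have FCG M j : FC C (G M j) by exact: resolution_in.
have exQ M : acyclic (hom_complex C (aug_complex (Q M))).
  exact: resolution_proper (PC_self C).
have exG M : acyclic (hom_complex C (aug_complex (G M))).
  exact: resolution_proper (PC_FC (PC_self C)).
pose gQ (M N : lmodType R) : {linear Tor i {linear C -> M} (C ⊗ N) -> RTor Q i M N} :=
  tor_eval i (exQ M) N.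
pose gG (M N : lmodType R) : {linear Tor i {linear C -> M} (C ⊗ N) -> RTor G i M N} :=
  tor_eval i (exG M) N.
have gQiso : natural_iso
    (fun M M' N N' f g => Tor_map i (hom_post f)
      (tensor_map (idfun : {linear C -> C}) g)) (RTor_map Q i) gQ.
  split=> [M M' N N' f g c|M N]; last exact: tor_eval_bij.
  by apply: tor_eval_natural => //; exact: liftP.
have gGiso : natural_iso
    (fun M M' N N' f g => Tor_map i (hom_post f)
      (tensor_map (idfun : {linear C -> C}) g)) (RTor_map G i) gG.
  split=> [M M' N N' f g c|M N]; last exact: tor_eval_bij.
  by apply: tor_eval_natural => //; exact: liftP.
(* Naturality for the comparison map Q -> G over the identity of M, with the
   identity of the free resolution as [psi]. *)
have rhoE M N c : rho Q G i M N (gQ M N c) = gG M N c.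
  have id_lifts : lifts (hom_post (idfun : {linear M -> M}))
      (id_chain (free_resolution {linear C -> M})).
    by move=> x; apply: linear_ext.
  have rhoP : lifts idfun
      (lift_chain idfun (resolution_in (Q M)) (@PC_proper _ _ G M)) by exact: liftP.
  rewrite -[LHS](tor_eval_natural hR fgC homC (exQ M) (exG M) idfun c
    (FCG M) rhoP id_lifts).
  congr (tor_eval i (exG M) N _); apply: homol_map_id => x.
  rewrite -[RHS]tensor_map_id; apply: tensor_map_eq => // t.
  exact: tensor_map_id.
split; [exact: natural_iso_inverse gQiso|by exists gG|].
exact: natural_iso_factor gQiso gGiso rhoE.
Qed.
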